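(* Let $M^2$ be a minimal surface in the unit sphere $S^3\subset\mathbb R^4$ whose Gauss curvature is not constant. If on $M^2$ there exists a (one-parameter) family of circles crossing the principal lines of $M^2$ under a constant angle $\theta$, then the circles are either principal lines ($\theta=0$ or $\theta=\pi/2$) or bisectrices of the principal lines ($\theta=\pi/4$ or $\theta=3\pi/4$).
   Context: $\mathbb R^4$ carries the standard Euclidean inner product and $S^3$ is its unit sphere. A surface $M^2$ in $S^3$ is given locally by a smooth map $l(u,v)$ with $\langle l,l\rangle=1$; $n$ denotes a unit normal of $M^2$ in $S^3$ (orthogonal to $l,l_u,l_v$). $M^2$ is minimal in $S^3$ if its mean curvature with respect to $n$ vanishes. Principal lines are the lines of curvature (curves tangent to eigendirections of the shape operator associated with $n$); the bisectrices of the principal lines are the curves making angle $\pi/4$ with both families of principal lines. A circle means a curve in $\mathbb R^4$ with constant first Frenet curvature and vanishing higher Frenet curvatures. All considerations are local. *)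

(* Defs.v *)
From Stdlib Require Import Reals Lra List.
From Coquelicot Require Import Coquelicot.
Open Scope R_scope.

(** Vectors of R^4 : only the components 0,1,2,3 are used. *)
Definition vec := nat -> R.
Definition dot (x y : vec) : R :=
  x 0%nat * y 0%nat + x 1%nat * y 1%nat + x 2%nat * y 2%nat + x 3%nat * y 3%nat.
Definition nrm (x : vec) : R := sqrt (dot x x).

Definition domain := R -> R -> Prop.
Definition open_dom (U : domain) : Prop := open (fun q : R * R => U (fst q) (snd q)).
Definition connected_dom (U : domain) : Prop :=
  forall A B : R * R -> Prop, open A -> open B ->
    (forall u v, U u v -> A (u, v) \/ B (u, v)) ->
    (forall u v, U u v -> A (u, v) -> B (u, v) -> False) ->
    (exists u v, U u v /\ A (u, v)) -> (exists u v, U u v /\ B (u, v)) -> False.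

Definition Du (f : R -> R -> R) : R -> R -> R := fun u v => Derive (fun t => f t v) u.
Definition Dv (f : R -> R -> R) : R -> R -> R := fun u v => Derive (fun t => f u t) v.
Fixpoint dpart (ds : list bool) (f : R -> R -> R) : R -> R -> R :=
  match ds with
  | nil => f
  | b :: ds' => if b then Du (dpart ds' f) else Dv (dpart ds' f)
  end.

Definition smooth_on (U : domain) (f : R -> R -> R) : Prop :=
  forall ds u v, U u v ->
    continuous (fun q : R * R => dpart ds f (fst q) (snd q)) (u, v) /\
    ex_derive (fun t => dpart ds f t v) u /\ ex_derive (fun t => dpart ds f u t) v.

Definition smooth_vec (U : domain) (l : R -> R -> vec) : Prop :=
  forall i, (i < 4)%nat -> smooth_on U (fun u v => l u v i).

Definition VDu (l : R -> R -> vec) : R -> R -> vec := fun u v i => Du (fun a b => l a b i) u v.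
Definition VDv (l : R -> R -> vec) : R -> R -> vec := fun u v i => Dv (fun a b => l a b i) u v.

Definition fE (l : R -> R -> vec) : R -> R -> R := fun u v => dot (VDu l u v) (VDu l u v).
Definition fF (l : R -> R -> vec) : R -> R -> R := fun u v => dot (VDu l u v) (VDv l u v).
Definition fG (l : R -> R -> vec) : R -> R -> R := fun u v => dot (VDv l u v) (VDv l u v).

Definition sL (l n : R -> R -> vec) : R -> R -> R := fun u v => dot (VDu (VDu l) u v) (n u v).
Definition sM (l n : R -> R -> vec) : R -> R -> R := fun u v => dot (VDv (VDu l) u v) (n u v).
Definition sN (l n : R -> R -> vec) : R -> R -> R := fun u v => dot (VDv (VDv l) u v) (n u v).

Definition mean_curv (l n : R -> R -> vec) (u v : R) : R :=
  (fE l u v * sN l n u v - 2 * fF l u v * sM l n u v + fG l u v * sL l n u v)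
  / (2 * (fE l u v * fG l u v - fF l u v ^ 2)).

(** Gauss curvature of the induced metric (Brioschi formula). *)
Definition det3 (a b c d e f g h i : R) : R :=
  a * (e * i - f * h) - b * (d * i - f * g) + c * (d * h - e * g).

Definition gauss_curv (l : R -> R -> vec) (u v : R) : R :=
  let E := fE l in let F := fF l in let G := fG l in
  (det3 (- Dv (Dv E) u v / 2 + Dv (Du F) u v - Du (Du G) u v / 2)
        (Du E u v / 2) (Du F u v - Dv E u v / 2)
        (Dv F u v - Du G u v / 2) (E u v) (F u v)
        (Dv G u v / 2) (F u v) (G u v)
   - det3 0 (Dv E u v / 2) (Du G u v / 2)
          (Dv E u v / 2) (E u v) (F u v)
          (Du G u v / 2) (F u v) (G u v))
  / (E u v * G u v - F u v ^ 2) ^ 2.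

Definition minimal_surface_S3 (U : domain) (l n : R -> R -> vec) : Prop :=
  smooth_vec U l /\ smooth_vec U n /\
  (forall u v, U u v -> dot (l u v) (l u v) = 1) /\
  (forall u v, U u v -> forall a b,
      (forall i, (i < 4)%nat -> a * VDu l u v i + b * VDv l u v i = 0) -> a = 0 /\ b = 0) /\
  (forall u v, U u v ->
      dot (n u v) (n u v) = 1 /\ dot (n u v) (l u v) = 0 /\
      dot (n u v) (VDu l u v) = 0 /\ dot (n u v) (VDv l u v) = 0) /\
  (forall u v, U u v -> mean_curv l n u v = 0).

Definition Ibil (l : R -> R -> vec) (u v a1 b1 a2 b2 : R) : R :=
  fE l u v * a1 * a2 + fF l u v * (a1 * b2 + b1 * a2) + fG l u v * b1 * b2.

(** (a,b) is a principal direction at (u,v): a l_u + b l_v is an eigenvector of the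
    shape operator S (defined by I(S x, y) = II(x, y)). *)
Definition principal_dir (l n : R -> R -> vec) (u v a b : R) : Prop :=
  (a <> 0 \/ b <> 0) /\
  exists k : R,
    sL l n u v * a + sM l n u v * b = k * (fE l u v * a + fF l u v * b) /\
    sM l n u v * a + sN l n u v * b = k * (fF l u v * a + fG l u v * b).

(** The tangent direction x1 l_u + x2 l_v crosses the principal lines at angle theta:
    it is parallel to cos theta e1 + sin theta e2, where e1 is a unit principal
    vector and e2 a unit vector orthogonal to e1. *)
Definition crosses_principal_at_angle (l n : R -> R -> vec) (theta u v x1 x2 : R) : Prop :=
  exists a1 b1 a2 b2 lam : R,
    principal_dir l n u v a1 b1 /\
    Ibil l u v a1 b1 a1 b1 = 1 /\ Ibil l u v a2 b2 a2 b2 = 1 /\ Ibil l u v a1 b1 a2 b2 = 0 /\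
    x1 = lam * (cos theta * a1 + sin theta * a2) /\
    x2 = lam * (cos theta * b1 + sin theta * b2).

(** A circle in R^4 (curve defined on the parameter set I): constant first Frenet
    curvature k1 and vanishing higher Frenet curvatures, i.e. the Frenet equations
    T' = |c'| k1 N,  N' = - |c'| k1 T  hold, with T = c'/|c'| and N a unit vector. *)
Definition is_circle (c : R -> vec) (I : R -> Prop) : Prop :=
  exists (c' : R -> vec) (k1 : R) (N : R -> vec), 0 <= k1 /\
  forall t, I t ->
    (forall i, (i < 4)%nat -> is_derive (fun s => c s i) t (c' t i)) /\
    nrm (c' t) <> 0 /\
    (forall i, (i < 4)%nat ->
       is_derive (fun s => c' s i / nrm (c' s)) t (nrm (c' t) * k1 * N t i)) /\
    nrm (N t) = 1 /\
    (forall i, (i < 4)%nat ->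
       is_derive (fun s => N s i) t (- (nrm (c' t) * k1) * (c' t i / nrm (c' t)))).

(** A one-parameter family of circles on the patch: the integral curves of a smooth
    nowhere vanishing direction field (X1, X2) on U, and through each point of U the
    integral curve is (the image under l of) a circle. *)
Definition circle_family (U : domain) (l : R -> R -> vec) (X1 X2 : R -> R -> R) : Prop :=
  smooth_on U X1 /\ smooth_on U X2 /\
  (forall u v, U u v -> X1 u v <> 0 \/ X2 u v <> 0) /\
  (forall u0 v0, U u0 v0 ->
     exists (delta : R) (g1 g2 : R -> R), 0 < delta /\ g1 0 = u0 /\ g2 0 = v0 /\
       (forall t, - delta < t < delta ->
          U (g1 t) (g2 t) /\
          is_derive g1 t (X1 (g1 t) (g2 t)) /\ is_derive g2 t (X2 (g1 t) (g2 t))) /\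
       is_circle (fun t => l (g1 t) (g2 t)) (fun t => - delta < t < delta)).

(* Main.v *)
(* Let T be the unit tangent field of the circles, B its rotation by a right angle in the surface,
   kap and om the geodesic curvatures <D_T T, B> and <D_B T, B>, p = II(T,T), q = II(T,B), and
   W = p^2 + q^2, so that K = 1 - W by the Gauss equation.  The circle condition reads
   T kap = p q and T p = - kap q, and the angle condition reads p^2 = cos(2 theta)^2 W.
   If cos(2 theta) and sin(2 theta) are both nonzero, then wherever W <> 0 the Codazzi equations
   give T W = - 4 W om and B W = 4 W kap; the circle condition then gives 2 p om = q kap, and
   comparing the two orders of differentiation of W gives T kap + B om = 0.  All derivatives of kap
   and om are thereby polynomials in p and q, the Gauss equation becomes
   kap^2 + om^2 + p^2 - q^2 / 2 = -1, and its derivative along T is 3 q^2 om = 0.  Hence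
   om = kap = 0, W is locally constant, and K is constant. *)
Require Import Defs.
From Stdlib Require Import Reals Lra Lia List Classical.
From Coquelicot Require Import Coquelicot.
Open Scope R_scope.

(** * Smooth functions of two variables *)

(** Principal directions make a poor frame: they are singular at umbilics, where W = 0, and the
    angle hypothesis picks them separately at each point. The frame T, B built from the normalised
    circle field is smooth on all of [U], and squaring the angle condition removes the ambiguity in
    the sign of the principal curvature. The signs of p and q stay undetermined, so the relations
    p^2 = C W and q^2 = (1 - C) W with C = cos(2 theta)^2 are differentiated instead of their roots,
    and p, q, W are cancelled only where W <> 0. At umbilics dW = 0 follows from the same relations,
    hence dW = 0 on all of [U] and connectedness applies. The circle condition is the Frenet system
    in the form D_T D_T T = - k1^2 T, with D the derivative of R^4; its B and n components are the
    two scalar equations. The Codazzi and Gauss equations for the frame express that derivatives in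
    the flat R^4 commute up to the bracket of T and B. The curvature given by Brioschi's formula is
    tied to W separately, through Gram determinants. *)

Lemma is_derive_0_const (h : R -> R) a b :
  (forall s, Rmin a b <= s <= Rmax a b -> is_derive h s 0) -> h b = h a.
Proof.
intros H; destruct (MVT_gen h a b (fun _ => 0)) as [c [_ E]].
- intros x Hx; apply H; lra.
- intros x Hx; apply continuity_pt_filterlim.
  apply (ex_derive_continuous h); exists 0; now apply H.
- lra.
Qed.

Section Calculus.

Variable U : R -> R -> Prop.
Hypothesis openU : open_dom U.

Lemma open_dom_square u v : U u v ->
  exists d : posreal, forall x y, Rabs (x - u) < d -> Rabs (y - v) < d -> U x y.
Proof.
intros H.
apply (proj2 (locally_2d_locally (fun x y => U x y) u v)).
exact (openU (u, v) H).
Qed.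

Lemma locally_dom_u u v : U u v -> locally u (fun t => U t v).
Proof.
intros H; destruct (open_dom_square u v H) as [d Hd]; exists d.
intros y Hy; apply Hd; [exact Hy|].
rewrite Rminus_diag, Rabs_R0; apply cond_pos.
Qed.

Lemma locally_dom_v u v : U u v -> locally v (fun t => U u t).
Proof.
intros H; destruct (open_dom_square u v H) as [d Hd]; exists d.
intros y Hy; apply Hd; [|exact Hy].
rewrite Rminus_diag, Rabs_R0; apply cond_pos.
Qed.

Section Ext.

Variables f g : R -> R -> R.
Hypothesis fg : forall u v, U u v -> f u v = g u v.

Lemma Du_ext u v : U u v -> Du f u v = Du g u v.
Proof.
intros H; apply Derive_ext_loc.
generalize (locally_dom_u u v H); apply filter_imp; intros t; apply fg.
Qed.

Lemma Dv_ext u v : U u v -> Dv f u v = Dv g u v.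
Proof.
intros H; apply Derive_ext_loc.
generalize (locally_dom_v u v H); apply filter_imp; intros t; apply fg.
Qed.

End Ext.

Definition diff_on (f : R -> R -> R) : Prop := forall u v, U u v ->
  continuous (fun q : R * R => f (fst q) (snd q)) (u, v) /\
  ex_derive (fun t => f t v) u /\ ex_derive (fun t => f u t) v.

Lemma diff_on_ext f g : (forall u v, U u v -> f u v = g u v) -> diff_on g -> diff_on f.
Proof.
intros fg Hg u v H; destruct (Hg u v H) as [c [du dv]]; split; [|split].
- unfold continuous; simpl; rewrite (fg u v H).
  apply filterlim_ext_loc with (fun q : R * R => g (fst q) (snd q)); [|exact c].
  generalize (openU (u, v) H); apply filter_imp.
  intros q Hq; symmetry; now apply fg.
- apply ex_derive_ext_loc with (fun t => g t v); [|exact du].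
  generalize (locally_dom_u u v H); apply filter_imp; intros t Ht; symmetry; now apply fg.
- apply ex_derive_ext_loc with (fun t => g u t); [|exact dv].
  generalize (locally_dom_v u v H); apply filter_imp; intros t Ht; symmetry; now apply fg.
Qed.

(** Smoothness graded by order. The recursion differentiates [f] itself, so closure under products,
    inverses and roots follows by induction from one application of the rule of differentiation,
    with no formula for iterated partials. *)
Fixpoint Ck (k : nat) (f : R -> R -> R) : Prop :=
  diff_on f /\ match k with 0%nat => True | S k' => Ck k' (Du f) /\ Ck k' (Dv f) end.

Lemma Ck_diff k f : Ck k f -> diff_on f.
Proof. destruct k; intros [H _]; exact H. Qed.

Lemma Ck_pred k : forall f, Ck (S k) f -> Ck k f.
Proof.
induction k as [|k IH]; intros f [H [Hu Hv]]; split; auto.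
Qed.

Lemma Ck_ext k : forall f g, (forall u v, U u v -> f u v = g u v) -> Ck k g -> Ck k f.
Proof.
induction k as [|k IH]; intros f g fg Hg.
- split; [|exact I]. apply diff_on_ext with g; [exact fg | exact (Ck_diff _ _ Hg)].
- destruct Hg as [Hg [Hu Hv]]; split; [now apply diff_on_ext with g|split].
  + apply IH with (Du g); [intros u v; now apply Du_ext | exact Hu].
  + apply IH with (Dv g); [intros u v; now apply Dv_ext | exact Hv].
Qed.

Lemma dpart_app ds ds' f : dpart (ds ++ ds') f = dpart ds (dpart ds' f).
Proof.
induction ds as [|b ds IH]; [reflexivity|].
simpl; rewrite IH; reflexivity.
Qed.

Lemma smooth_on_Du f : smooth_on U f -> smooth_on U (Du f).
Proof.
intros H ds; change (Du f) with (dpart (true :: nil) f).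
rewrite <- dpart_app; apply H.
Qed.

Lemma smooth_on_Dv f : smooth_on U f -> smooth_on U (Dv f).
Proof.
intros H ds; change (Dv f) with (dpart (false :: nil) f).
rewrite <- dpart_app; apply H.
Qed.

Lemma smooth_on_Ck f : smooth_on U f <-> forall k, Ck k f.
Proof.
split.
- intros H k; revert f H; induction k as [|k IH]; intros f H.
  + split; [exact (H nil) | exact I].
  + split; [exact (H nil)|split; apply IH].
    * now apply smooth_on_Du.
    * now apply smooth_on_Dv.
(* The last entry of [ds] is the derivative applied first, which is the one that [Ck] peels off. *)
- intros H ds; revert f H; induction ds as [|b ds IH] using rev_ind; intros f H.
  + exact (Ck_diff 0 f (H 0%nat)).
  + rewrite dpart_app; apply IH; intros k.
    destruct (H (S k)) as [_ [Hu Hv]]; destruct b; simpl; assumption.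
Qed.

Lemma smooth_on_ext f g :
  (forall u v, U u v -> f u v = g u v) -> smooth_on U g -> smooth_on U f.
Proof.
intros fg Hg; apply smooth_on_Ck; intros k; apply Ck_ext with g; [exact fg|].
now apply smooth_on_Ck.
Qed.

Lemma smooth_on_diff f : smooth_on U f -> diff_on f.
Proof. intros H; exact (H nil). Qed.

Lemma Ck_const c k : Ck k (fun _ _ => c).
Proof.
assert (D : forall c, diff_on (fun _ _ => c)).
{ intros c' u v _; split; [apply continuous_const|split; apply ex_derive_const]. }
revert c; induction k as [|k IH]; intros c; split; auto.
split; apply Ck_ext with (fun _ _ => 0); auto; intros u v _; exact (Derive_const c _).
Qed.

Lemma diff_on_plus f g : diff_on f -> diff_on g -> diff_on (fun u v => f u v + g u v).
Proof.
intros Hf Hg u v H; destruct (Hf u v H) as [cf [fu fv]], (Hg u v H) as [cg [gu gv]].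
split; [|split; now apply @ex_derive_plus].
exact (@continuous_plus _ _ _ (fun q : R * R => f (fst q) (snd q)) (fun q : R * R => g (fst q) (snd q)) _ cf cg).
Qed.

Lemma Du_plus f g u v : diff_on f -> diff_on g -> U u v ->
  Du (fun a b => f a b + g a b) u v = Du f u v + Du g u v.
Proof.
intros Hf Hg H; destruct (Hf u v H) as [_ [fu _]], (Hg u v H) as [_ [gu _]].
exact (Derive_plus (fun t => f t v) (fun t => g t v) u fu gu).
Qed.

Lemma Dv_plus f g u v : diff_on f -> diff_on g -> U u v ->
  Dv (fun a b => f a b + g a b) u v = Dv f u v + Dv g u v.
Proof.
intros Hf Hg H; destruct (Hf u v H) as [_ [_ fv]], (Hg u v H) as [_ [_ gv]].
exact (Derive_plus (fun t => f u t) (fun t => g u t) v fv gv).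
Qed.

Lemma Ck_plus k : forall f g, Ck k f -> Ck k g -> Ck k (fun u v => f u v + g u v).
Proof.
induction k as [|k IH]; intros f g Hf Hg; destruct Hf as [Hf Hf'], Hg as [Hg Hg'];
  (split; [now apply diff_on_plus|]); [exact I|].
destruct Hf' as [fu fv], Hg' as [gu gv]; split.
- apply Ck_ext with (fun u v => Du f u v + Du g u v); [|now apply IH].
  intros u v; now apply Du_plus.
- apply Ck_ext with (fun u v => Dv f u v + Dv g u v); [|now apply IH].
  intros u v; now apply Dv_plus.
Qed.

Lemma diff_on_mult f g : diff_on f -> diff_on g -> diff_on (fun u v => f u v * g u v).
Proof.
intros Hf Hg u v H; destruct (Hf u v H) as [cf [fu fv]], (Hg u v H) as [cg [gu gv]].
split; [|split; now apply @ex_derive_mult].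
exact (@continuous_mult _ _ (fun q : R * R => f (fst q) (snd q)) (fun q : R * R => g (fst q) (snd q)) _ cf cg).
Qed.

Lemma Du_mult f g u v : diff_on f -> diff_on g -> U u v ->
  Du (fun a b => f a b * g a b) u v = Du f u v * g u v + f u v * Du g u v.
Proof.
intros Hf Hg H; destruct (Hf u v H) as [_ [fu _]], (Hg u v H) as [_ [gu _]].
exact (Derive_mult (fun t => f t v) (fun t => g t v) u fu gu).
Qed.

Lemma Dv_mult f g u v : diff_on f -> diff_on g -> U u v ->
  Dv (fun a b => f a b * g a b) u v = Dv f u v * g u v + f u v * Dv g u v.
Proof.
intros Hf Hg H; destruct (Hf u v H) as [_ [_ fv]], (Hg u v H) as [_ [_ gv]].
exact (Derive_mult (fun t => f u t) (fun t => g u t) v fv gv).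
Qed.

(** The Leibniz rule pairs a derivative, of class [k], with an undifferentiated factor of class
    [S k]; [Ck_pred] brings the latter down to [k]. *)
Lemma Ck_mult k : forall f g, Ck k f -> Ck k g -> Ck k (fun u v => f u v * g u v).
Proof.
induction k as [|k IH]; intros f g Hf Hg.
- split; [apply diff_on_mult; eapply Ck_diff; eassumption | exact I].
- pose proof (Ck_pred _ _ Hf) as Hf0; pose proof (Ck_pred _ _ Hg) as Hg0.
  destruct Hf as [Hf [fu fv]], Hg as [Hg [gu gv]].
  split; [now apply diff_on_mult|split].
  + apply Ck_ext with (fun u v => Du f u v * g u v + f u v * Du g u v).
    * intros u v; now apply Du_mult.
    * apply Ck_plus; now apply IH.
  + apply Ck_ext with (fun u v => Dv f u v * g u v + f u v * Dv g u v).
    * intros u v; now apply Dv_mult.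
    * apply Ck_plus; now apply IH.
Qed.

Lemma diff_on_inv f : (forall u v, U u v -> f u v <> 0) -> diff_on f ->
  diff_on (fun u v => / f u v).
Proof.
intros nz Hf u v H; destruct (Hf u v H) as [cf [fu fv]].
split; [|split; apply ex_derive_inv; auto].
apply (continuous_comp (fun q : R * R => f (fst q) (snd q)) Rinv); [exact cf|].
apply continuous_Rinv; now apply nz.
Qed.

(** The derivative is written as a product of f' with two copies of 1/f, so that the induction
    hypothesis for 1/f and [Ck_mult] suffice. *)
Lemma Ck_inv k f : (forall u v, U u v -> f u v <> 0) -> Ck k f -> Ck k (fun u v => / f u v).
Proof.
intros nz; induction k as [|k IH]; intros Hf.
- split; [apply diff_on_inv; auto; eapply Ck_diff; eassumption | exact I].
- pose proof (IH (Ck_pred _ _ Hf)) as Hi.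
  destruct Hf as [Hf [fu fv]].
  split; [now apply diff_on_inv|split].
  + apply Ck_ext with (fun u v => (-1 * Du f u v) * (/ f u v * / f u v)).
    * intros u v H; destruct (Hf u v H) as [_ [du _]].
      replace (-1 * Du f u v * (/ f u v * / f u v)) with (- Du f u v / f u v ^ 2)
        by (field; now apply nz).
      apply (Derive_inv (fun t => f t v) u); [exact du | now apply nz].
    * repeat apply Ck_mult; auto; apply Ck_const.
  + apply Ck_ext with (fun u v => (-1 * Dv f u v) * (/ f u v * / f u v)).
    * intros u v H; destruct (Hf u v H) as [_ [_ dv]].
      replace (-1 * Dv f u v * (/ f u v * / f u v)) with (- Dv f u v / f u v ^ 2)
        by (field; now apply nz).
      apply (Derive_inv (fun t => f u t) v); [exact dv | now apply nz].
    * repeat apply Ck_mult; auto; apply Ck_const.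
Qed.

Lemma diff_on_sqrt f : (forall u v, U u v -> 0 < f u v) -> diff_on f ->
  diff_on (fun u v => sqrt (f u v)).
Proof.
intros pos Hf u v H; destruct (Hf u v H) as [cf [fu fv]].
split; [|split].
- apply (continuous_comp (fun q : R * R => f (fst q) (snd q)) sqrt); [exact cf|].
  apply continuous_sqrt.
- eexists; apply is_derive_sqrt; [now apply Derive_correct | now apply pos].
- eexists; apply is_derive_sqrt; [now apply Derive_correct | now apply pos].
Qed.

(** The derivative f' / (2 sqrt f) contains the root again, one order lower; the induction
    hypothesis and [Ck_inv] handle it. *)
Lemma Ck_sqrt k f : (forall u v, U u v -> 0 < f u v) -> Ck k f -> Ck k (fun u v => sqrt (f u v)).
Proof.
intros pos; induction k as [|k IH]; intros Hf.
- split; [apply diff_on_sqrt; auto; eapply Ck_diff; eassumption | exact I].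
- pose proof (IH (Ck_pred _ _ Hf)) as Hi.
  assert (snz : forall u v, U u v -> sqrt (f u v) <> 0).
  { intros u v H; apply Rgt_not_eq, sqrt_lt_R0; now apply pos. }
  destruct Hf as [Hf [fu fv]].
  split; [now apply diff_on_sqrt|split].
  + apply Ck_ext with (fun u v => (/ 2 * Du f u v) * / sqrt (f u v)).
    * intros u v H; destruct (Hf u v H) as [_ [du _]].
      apply is_derive_unique.
      replace (/ 2 * Du f u v * / sqrt (f u v)) with (Du f u v / (2 * sqrt (f u v)))
        by (field; now apply snz).
      apply (is_derive_sqrt (fun t => f t v)); [now apply Derive_correct | now apply pos].
    * repeat apply Ck_mult; auto; [apply Ck_const | now apply Ck_inv].
  + apply Ck_ext with (fun u v => (/ 2 * Dv f u v) * / sqrt (f u v)).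
    * intros u v H; destruct (Hf u v H) as [_ [_ dv]].
      apply is_derive_unique.
      replace (/ 2 * Dv f u v * / sqrt (f u v)) with (Dv f u v / (2 * sqrt (f u v)))
        by (field; now apply snz).
      apply (is_derive_sqrt (fun t => f u t)); [now apply Derive_correct | now apply pos].
    * repeat apply Ck_mult; auto; [apply Ck_const | now apply Ck_inv].
Qed.

Lemma smooth_on_const c : smooth_on U (fun _ _ => c).
Proof. apply smooth_on_Ck; intros k; apply Ck_const. Qed.

Lemma smooth_on_plus f g : smooth_on U f -> smooth_on U g -> smooth_on U (fun u v => f u v + g u v).
Proof.
intros Hf Hg; apply smooth_on_Ck; intros k; apply Ck_plus; now apply smooth_on_Ck.
Qed.

Lemma smooth_on_mult f g : smooth_on U f -> smooth_on U g -> smooth_on U (fun u v => f u v * g u v).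
Proof.
intros Hf Hg; apply smooth_on_Ck; intros k; apply Ck_mult; now apply smooth_on_Ck.
Qed.

Lemma smooth_on_opp f : smooth_on U f -> smooth_on U (fun u v => - f u v).
Proof.
intros Hf; apply smooth_on_ext with (fun u v => -1 * f u v); [intros; ring|].
apply smooth_on_mult; [apply smooth_on_const | exact Hf].
Qed.

Lemma smooth_on_minus f g : smooth_on U f -> smooth_on U g -> smooth_on U (fun u v => f u v - g u v).
Proof. intros Hf Hg; apply smooth_on_plus; [exact Hf | now apply smooth_on_opp]. Qed.

Lemma smooth_on_inv f : (forall u v, U u v -> f u v <> 0) ->
  smooth_on U f -> smooth_on U (fun u v => / f u v).
Proof.
intros nz Hf; apply smooth_on_Ck; intros k; apply Ck_inv; [exact nz | now apply smooth_on_Ck].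
Qed.

Lemma smooth_on_sqrt f : (forall u v, U u v -> 0 < f u v) ->
  smooth_on U f -> smooth_on U (fun u v => sqrt (f u v)).
Proof.
intros pos Hf; apply smooth_on_Ck; intros k; apply Ck_sqrt; [exact pos | now apply smooth_on_Ck].
Qed.

Lemma smooth_on_continuity_2d f u v : smooth_on U f -> U u v ->
  continuity_2d_pt f u v.
Proof.
intros Hf H; apply continuity_2d_pt_filterlim; exact (proj1 (Hf nil u v H)).
Qed.

Lemma Du_Dv_comm f u v : smooth_on U f -> U u v -> Du (Dv f) u v = Dv (Du f) u v.
Proof.
intros Hf H; apply (Schwarz f u v).
- apply locally_2d_locally; generalize (openU (u, v) H); apply filter_imp.
  intros [x y] Hxy; simpl in *.
  destruct (Hf nil x y Hxy) as [_ [fu fv]].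
  destruct (Hf (true :: nil) x y Hxy) as [_ [_ fuv]].
  destruct (Hf (false :: nil) x y Hxy) as [_ [fvu _]].
  repeat split; assumption.
- apply (smooth_on_continuity_2d (Du (Dv f))); [now apply smooth_on_Du, smooth_on_Dv | exact H].
- apply (smooth_on_continuity_2d (Dv (Du f))); [now apply smooth_on_Dv, smooth_on_Du | exact H].
Qed.

Lemma is_derive_comp_2d f (g1 g2 : R -> R) t l1 l2 :
  smooth_on U f -> U (g1 t) (g2 t) -> is_derive g1 t l1 -> is_derive g2 t l2 ->
  is_derive (fun s => f (g1 s) (g2 s)) t (l1 * Du f (g1 t) (g2 t) + l2 * Dv f (g1 t) (g2 t)).
Proof.
intros Hf H D1 D2.
apply (filterdiff_comp'_2 g1 g2 f t _ _
  (fun a b => a * Du f (g1 t) (g2 t) + b * Dv f (g1 t) (g2 t)) D1) in D2.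
- eapply filterdiff_ext_lin; [exact D2|].
  intros y; unfold scal; simpl; unfold mult; simpl; ring.
- apply (is_derive_filterdiff f (g1 t) (g2 t) (Du f)).
  + generalize (openU (g1 t, g2 t) H); apply filter_imp; intros [x y] Hxy; simpl in *.
    apply Derive_correct; exact (proj1 (proj2 (Hf nil x y Hxy))).
  + apply Derive_correct; exact (proj2 (proj2 (Hf nil (g1 t) (g2 t) H))).
  + exact (proj1 (Hf (true :: nil) (g1 t) (g2 t) H)).
Qed.

Lemma locally_const f u v : diff_on f ->
  (forall x y, U x y -> Du f x y = 0 /\ Dv f x y = 0) -> U u v ->
  locally (u, v) (fun q : R * R => U (fst q) (snd q) /\ f (fst q) (snd q) = f u v).
Proof.
intros Hf df H; destruct (open_dom_square u v H) as [d Hd].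
apply locally_2d_locally with (P := fun x y => U x y /\ f x y = f u v).
exists d; intros x y Hx Hy; split; [now apply Hd|].
assert (Hxs : forall s, Rmin u x <= s <= Rmax u x -> Rabs (s - u) < d).
{ intros s; revert Hx; unfold Rmin, Rmax, Rabs.
  destruct (Rle_dec u x), (Rcase_abs (x - u)), (Rcase_abs (s - u)); lra. }
assert (Hys : forall s, Rmin v y <= s <= Rmax v y -> Rabs (s - v) < d).
{ intros s; revert Hy; unfold Rmin, Rmax, Rabs.
  destruct (Rle_dec v y), (Rcase_abs (y - v)), (Rcase_abs (s - v)); lra. }
(* The point (u, y) is the corner of an L-shaped path from (u, v) to (x, y) inside the square. *)
transitivity (f u y).
- apply (is_derive_0_const (fun t => f t y)); intros s Hs.
  assert (HU : U s y) by (apply Hd; auto).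
  rewrite <- (proj1 (df s y HU)); apply Derive_correct; exact (proj1 (proj2 (Hf s y HU))).
- apply (is_derive_0_const (fun t => f u t)); intros s Hs.
  assert (HU : U u s).
  { apply Hd; [rewrite Rminus_diag, Rabs_R0; apply cond_pos | auto]. }
  rewrite <- (proj2 (df u s HU)); apply Derive_correct; exact (proj2 (proj2 (Hf u s HU))).
Qed.

(** Local constancy makes both the level set of [f u v] and its complement in [U] open, so the
    complement is empty. *)
Lemma connected_const f : connected_dom U -> diff_on f ->
  (forall x y, U x y -> Du f x y = 0 /\ Dv f x y = 0) ->
  forall u v x y, U u v -> U x y -> f x y = f u v.
Proof.
intros conn Hf df u v x y Huv Hxy.
destruct (Req_dec (f x y) (f u v)) as [E|N]; [exact E|exfalso].
apply (conn (fun q => U (fst q) (snd q) /\ f (fst q) (snd q) = f u v)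
            (fun q => U (fst q) (snd q) /\ f (fst q) (snd q) <> f u v)); simpl.
- intros [a b] [Hab E]; simpl in *; rewrite <- E; now apply locally_const.
- intros [a b] [Hab E]; simpl in *; generalize (locally_const f a b Hf df Hab).
  apply filter_imp; intros q [Hq Eq]; rewrite Eq; now split.
- intros a b Hab; destruct (Req_dec (f a b) (f u v)); auto.
- intros a b _ [_ E] [_ N']; contradiction.
- exists u, v; auto.
- exists x, y; auto.
Qed.

End Calculus.

Ltac smooth :=
  match goal with
  | |- smooth_on ?U (fun u v => @?f u v + @?g u v) =>
      refine (smooth_on_plus U _ f g _ _); [assumption | smooth | smooth]
  | |- smooth_on ?U (fun u v => @?f u v - @?g u v) =>
      refine (smooth_on_minus U _ f g _ _); [assumption | smooth | smooth]
  | |- smooth_on ?U (fun u v => @?f u v * @?g u v) =>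
      refine (smooth_on_mult U _ f g _ _); [assumption | smooth | smooth]
  | |- smooth_on ?U (fun u v => - @?f u v) =>
      refine (smooth_on_opp U _ f _); [assumption | smooth]
  | |- smooth_on ?U (fun _ _ => ?c) => apply smooth_on_const; assumption
  | _ => auto
  end.

(** * Derivatives along vector fields *)

Definition Dir (a b f : R -> R -> R) : R -> R -> R :=
  fun u v => a u v * Du f u v + b u v * Dv f u v.
(** This is the flat derivative of R^4, taken componentwise; its normal components carry the second
    fundamental form. *)
Definition VDir (a b : R -> R -> R) (V : R -> R -> vec) : R -> R -> vec :=
  fun u v i => Dir a b (fun x y => V x y i) u v.

Section Directional.

Variable U : R -> R -> Prop.
Hypothesis openU : open_dom U.

Lemma smooth_on_Dir a b f : smooth_on U a -> smooth_on U b -> smooth_on U f ->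
  smooth_on U (Dir a b f).
Proof.
intros Ha Hb Hf; apply smooth_on_plus; [exact openU| |]; apply smooth_on_mult; auto.
- now apply smooth_on_Du.
- now apply smooth_on_Dv.
Qed.

Lemma smooth_vec_VDir a b V : smooth_on U a -> smooth_on U b -> smooth_vec U V ->
  smooth_vec U (VDir a b V).
Proof. intros Ha Hb HV i Hi; apply smooth_on_Dir; auto; exact (HV i Hi). Qed.

Lemma smooth_on_dot V W : smooth_vec U V -> smooth_vec U W ->
  smooth_on U (fun u v => dot (V u v) (W u v)).
Proof.
intros HV HW; unfold dot.
pose proof (HV 0%nat ltac:(lia)); pose proof (HV 1%nat ltac:(lia)).
pose proof (HV 2%nat ltac:(lia)); pose proof (HV 3%nat ltac:(lia)).
pose proof (HW 0%nat ltac:(lia)); pose proof (HW 1%nat ltac:(lia)).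
pose proof (HW 2%nat ltac:(lia)); pose proof (HW 3%nat ltac:(lia)).
smooth.
Qed.

Lemma Dir_ext a b f g u v : (forall u v, U u v -> f u v = g u v) -> U u v ->
  Dir a b f u v = Dir a b g u v.
Proof.
intros fg H; unfold Dir.
rewrite (Du_ext U openU f g fg u v H), (Dv_ext U openU f g fg u v H); reflexivity.
Qed.

Lemma Dir_const a b c u v : Dir a b (fun _ _ => c) u v = 0.
Proof.
unfold Dir; replace (Du _ u v) with 0; [replace (Dv _ u v) with 0; [ring|]|];
  symmetry; apply (Derive_const c).
Qed.

Lemma Dir_plus a b f g u v : smooth_on U f -> smooth_on U g -> U u v ->
  Dir a b (fun x y => f x y + g x y) u v = Dir a b f u v + Dir a b g u v.
Proof.
intros Hf Hg H; unfold Dir.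
rewrite (Du_plus U f g u v), (Dv_plus U f g u v); try apply smooth_on_diff; auto; ring.
Qed.

Lemma Dir_plus4 a b f g h k u v :
  smooth_on U f -> smooth_on U g -> smooth_on U h -> smooth_on U k -> U u v ->
  Dir a b (fun x y => f x y + g x y + h x y + k x y) u v =
  Dir a b f u v + Dir a b g u v + Dir a b h u v + Dir a b k u v.
Proof.
intros Hf Hg Hh Hk H.
rewrite (Dir_plus a b (fun x y => f x y + g x y + h x y) k),
  (Dir_plus a b (fun x y => f x y + g x y) h), (Dir_plus a b f g); try assumption; smooth.
Qed.

Lemma Dir_mult a b f g u v : smooth_on U f -> smooth_on U g -> U u v ->
  Dir a b (fun x y => f x y * g x y) u v = Dir a b f u v * g u v + f u v * Dir a b g u v.
Proof.
intros Hf Hg H; unfold Dir.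
rewrite (Du_mult U f g u v), (Dv_mult U f g u v); try apply smooth_on_diff; auto; ring.
Qed.

Lemma Dir_dot a b V W u v : smooth_vec U V -> smooth_vec U W -> U u v ->
  Dir a b (fun x y => dot (V x y) (W x y)) u v =
  dot (VDir a b V u v) (W u v) + dot (V u v) (VDir a b W u v).
Proof.
intros HV HW H; unfold dot at 1.
assert (S : forall i, (i < 4)%nat -> smooth_on U (fun x y => V x y i * W x y i)).
{ intros i Hi; apply smooth_on_mult; [exact openU | exact (HV i Hi) | exact (HW i Hi)]. }
assert (P : forall i, (i < 4)%nat -> Dir a b (fun x y => V x y i * W x y i) u v =
  VDir a b V u v i * W u v i + V u v i * VDir a b W u v i).
{ intros i Hi; exact (Dir_mult a b _ _ u v (HV i Hi) (HW i Hi) H). }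
rewrite (Dir_plus4 a b _ _ _ _ u v (S 0%nat ltac:(lia)) (S 1%nat ltac:(lia))
  (S 2%nat ltac:(lia)) (S 3%nat ltac:(lia)) H).
rewrite !P by lia; unfold dot; ring.
Qed.

Lemma Dir_dot_const a b V W c u v : smooth_vec U V -> smooth_vec U W ->
  (forall u v, U u v -> dot (V u v) (W u v) = c) -> U u v ->
  dot (VDir a b V u v) (W u v) + dot (V u v) (VDir a b W u v) = 0.
Proof.
intros HV HW E H; rewrite <- Dir_dot by assumption.
rewrite (Dir_ext a b _ (fun _ _ => c)); [apply Dir_const | exact E | exact H].
Qed.

(** Second-order terms cancel by the symmetry of mixed partials; what remains is the Lie bracket of
    the two fields, applied to [f]. *)
Lemma Dir_comm a b c d f u v :
  smooth_on U a -> smooth_on U b -> smooth_on U c -> smooth_on U d -> smooth_on U f -> U u v ->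
  Dir a b (Dir c d f) u v - Dir c d (Dir a b f) u v =
  (Dir a b c u v - Dir c d a u v) * Du f u v + (Dir a b d u v - Dir c d b u v) * Dv f u v.
Proof.
intros Ha Hb Hc Hd Hf H.
assert (Hu := smooth_on_Du U f Hf); assert (Hv := smooth_on_Dv U f Hf).
assert (L : forall a b c d, smooth_on U c -> smooth_on U d ->
  Dir a b (Dir c d f) u v = Dir a b c u v * Du f u v + c u v * Dir a b (Du f) u v
    + (Dir a b d u v * Dv f u v + d u v * Dir a b (Dv f) u v)).
{ intros a' b' c' d' Hc' Hd'; unfold Dir at 2.
  rewrite (Dir_plus a' b' (fun x y => c' x y * Du f x y) (fun x y => d' x y * Dv f x y));
    auto; try (apply smooth_on_mult; auto).
  rewrite !Dir_mult by assumption; reflexivity. }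
rewrite (L a b c d), (L c d a b) by assumption.
unfold Dir; rewrite (Du_Dv_comm U openU f u v Hf H); ring.
Qed.

End Directional.

(** * Euclidean space R^4 *)

Lemma dot_comm x y : dot x y = dot y x.
Proof. unfold dot; ring. Qed.

Lemma dot_self_eq0 x : dot x x = 0 -> forall i, (i < 4)%nat -> x i = 0.
Proof.
unfold dot; intros H i Hi.
assert (x 0%nat = 0 /\ x 1%nat = 0 /\ x 2%nat = 0 /\ x 3%nat = 0).
{ repeat split; nra. }
destruct i as [|[|[|[|i]]]]; try tauto; lia.
Qed.

Lemma dot_lin_l a b x y w z : (forall i, (i < 4)%nat -> w i = a * x i + b * y i) ->
  dot w z = a * dot x z + b * dot y z.
Proof. intros H; unfold dot; rewrite !H by lia; ring. Qed.

Lemma parseval e1 e2 e3 e4 x y :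
  dot e1 e1 = 1 -> dot e2 e2 = 1 -> dot e3 e3 = 1 -> dot e4 e4 = 1 ->
  dot e1 e2 = 0 -> dot e1 e3 = 0 -> dot e1 e4 = 0 ->
  dot e2 e3 = 0 -> dot e2 e4 = 0 -> dot e3 e4 = 0 ->
  dot x y = dot x e1 * dot y e1 + dot x e2 * dot y e2 + dot x e3 * dot y e3 + dot x e4 * dot y e4.
Proof.
intros g11 g22 g33 g44 g12 g13 g14 g23 g24 g34.
set (P j k := e1 j * e1 k + e2 j * e2 k + e3 j * e3 k + e4 j * e4 k).
(* The Frobenius norm of [I - P] is computed from the Gram matrix alone, and it vanishes. *)
assert (S : (1 - P 0%nat 0%nat) ^ 2 + (1 - P 1%nat 1%nat) ^ 2 + (1 - P 2%nat 2%nat) ^ 2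
  + (1 - P 3%nat 3%nat) ^ 2 + 2 * (P 0%nat 1%nat ^ 2 + P 0%nat 2%nat ^ 2 + P 0%nat 3%nat ^ 2
  + P 1%nat 2%nat ^ 2 + P 1%nat 3%nat ^ 2 + P 2%nat 3%nat ^ 2) = 0).
(* The norm expands to 4 - 2 tr P + tr P^2, and both traces equal those of the Gram matrix and of
   its square: 4 - 8 + 4 = 0. *)
{ transitivity (4 - 2 * (dot e1 e1 + dot e2 e2 + dot e3 e3 + dot e4 e4)
    + (dot e1 e1 ^ 2 + dot e2 e2 ^ 2 + dot e3 e3 ^ 2 + dot e4 e4 ^ 2)
    + 2 * (dot e1 e2 ^ 2 + dot e1 e3 ^ 2 + dot e1 e4 ^ 2 + dot e2 e3 ^ 2 + dot e2 e4 ^ 2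
      + dot e3 e4 ^ 2)).
  - unfold P, dot; ring.
  - rewrite g11, g22, g33, g44, g12, g13, g14, g23, g24, g34; ring. }
assert (Q : forall j k, (j < 4)%nat -> (k < 4)%nat -> P j k = if Nat.eqb j k then 1 else 0).
{ assert (C : forall j k, P j k = P k j) by (intros; unfold P; ring).
  assert (Z : forall r, r ^ 2 <= 0 -> r = 0) by (intros r Hr; nra).
  pose proof (fun j k => pow2_ge_0 (P j k)) as N.
  pose proof (fun j => pow2_ge_0 (1 - P j j)) as N'.
  pose proof (N 0 1)%nat; pose proof (N 0 2)%nat; pose proof (N 0 3)%nat.
  pose proof (N 1 2)%nat; pose proof (N 1 3)%nat; pose proof (N 2 3)%nat.
  pose proof (N' 0)%nat; pose proof (N' 1)%nat; pose proof (N' 2)%nat; pose proof (N' 3)%nat.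
  assert (D : forall j, (j < 4)%nat -> P j j = 1).
  { intros j Hj; cut (1 - P j j = 0); [lra|apply Z].
    destruct j as [|[|[|[|j]]]]; try lia; lra. }
  assert (O : forall j k, (j < k < 4)%nat -> P j k = 0).
  { intros j k Hjk; apply Z.
    destruct k as [|[|[|[|k]]]]; try lia; destruct j as [|[|[|j]]]; try lia; lra. }
  intros j k Hj Hk; destruct (Nat.eqb_spec j k) as [<-|Njk]; [now apply D|].
  destruct (Nat.lt_total j k) as [L|[E|L]]; [|contradiction|rewrite C]; apply O; lia. }
(* The subtracted term is the bilinear form of I - P at (x, y): it vanishes by [Q], and removing it
   turns x.y into x.Py, the sum over the frame. *)
transitivity (dot x y - ((1 - P 0%nat 0%nat) * x 0%nat * y 0%nat
   + (1 - P 1%nat 1%nat) * x 1%nat * y 1%nat + (1 - P 2%nat 2%nat) * x 2%nat * y 2%nat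
   + (1 - P 3%nat 3%nat) * x 3%nat * y 3%nat
   - P 0%nat 1%nat * (x 0%nat * y 1%nat + x 1%nat * y 0%nat)
   - P 0%nat 2%nat * (x 0%nat * y 2%nat + x 2%nat * y 0%nat)
   - P 0%nat 3%nat * (x 0%nat * y 3%nat + x 3%nat * y 0%nat)
   - P 1%nat 2%nat * (x 1%nat * y 2%nat + x 2%nat * y 1%nat)
   - P 1%nat 3%nat * (x 1%nat * y 3%nat + x 3%nat * y 1%nat)
   - P 2%nat 3%nat * (x 2%nat * y 3%nat + x 3%nat * y 2%nat))).
- rewrite !Q by lia; simpl; ring.
- unfold P, dot; ring.
Qed.

(* For [A g A^T = I], the reversed product gives [A^T A = g^-1]. *)
Lemma orthonormal_inverse E F G a b c d :
  E * a ^ 2 + 2 * F * a * b + G * b ^ 2 = 1 ->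
  E * c ^ 2 + 2 * F * c * d + G * d ^ 2 = 1 ->
  E * a * c + F * (a * d + b * c) + G * b * d = 0 ->
  let D := E * G - F ^ 2 in
  (a * d - b * c) ^ 2 * D = 1 /\
  D * (a ^ 2 + c ^ 2) = G /\ D * (a * b + c * d) = - F /\ D * (b ^ 2 + d ^ 2) = E.
Proof.
intros H1 H2 H3 D.
assert (HD : (a * d - b * c) ^ 2 * D = 1).
{ transitivity ((E * a ^ 2 + 2 * F * a * b + G * b ^ 2) * (E * c ^ 2 + 2 * F * c * d + G * d ^ 2)
    - (E * a * c + F * (a * d + b * c) + G * b * d) ^ 2).
  - unfold D; ring.
  - rewrite H1, H2, H3; ring. }
assert (nz : (a * d - b * c) ^ 2 <> 0) by (intros Z; rewrite Z in HD; lra).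
(* With A the matrix with rows (a, b) and (c, d), the entries of A g A^T are w, m, z. Cramer's rule
   recovers det(A)^2 g from them, and only then are the values 1, 0, 1 inserted. *)
set (w := E * a ^ 2 + 2 * F * a * b + G * b ^ 2) in *.
set (z := E * c ^ 2 + 2 * F * c * d + G * d ^ 2) in *.
set (m := E * a * c + F * (a * d + b * c) + G * b * d) in *.
assert (EG : (a * d - b * c) ^ 2 * G = w * c ^ 2 - 2 * m * a * c + z * a ^ 2)
  by (unfold w, z, m; ring).
assert (EF : (a * d - b * c) ^ 2 * F = - (w * c * d) + m * (a * d + b * c) - z * a * b)
  by (unfold w, z, m; ring).
assert (EE : (a * d - b * c) ^ 2 * E = w * d ^ 2 - 2 * m * b * d + z * b ^ 2)
  by (unfold w, z, m; ring).
rewrite H1, H2, H3 in EG, EF, EE.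
split; [exact HD|]; repeat split; apply Rmult_eq_reg_l with ((a * d - b * c) ^ 2); auto.
- rewrite EG; transitivity ((a * d - b * c) ^ 2 * D * (a ^ 2 + c ^ 2)); [ring|rewrite HD; ring].
- transitivity ((a * d - b * c) ^ 2 * D * (a * b + c * d)); [ring|rewrite HD].
  transitivity (- ((a * d - b * c) ^ 2 * F)); [rewrite EF; ring|ring].
- rewrite EE; transitivity ((a * d - b * c) ^ 2 * D * (b ^ 2 + d ^ 2)); [ring|rewrite HD; ring].
Qed.

(** Trace and determinant of II relative to I can be computed in any orthonormal frame. The
    hypothesis on [E * N - 2 * F * M + G * L] says that the trace vanishes, so II has the matrix (p,
    q; q, -p) with determinant - p^2 - q^2. *)
Lemma traceless_form E F G L M N a b c d :
  E * a ^ 2 + 2 * F * a * b + G * b ^ 2 = 1 ->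
  E * c ^ 2 + 2 * F * c * d + G * d ^ 2 = 1 ->
  E * a * c + F * (a * d + b * c) + G * b * d = 0 ->
  E * N - 2 * F * M + G * L = 0 ->
  L * c ^ 2 + 2 * M * c * d + N * d ^ 2 = - (L * a ^ 2 + 2 * M * a * b + N * b ^ 2) /\
  (L * a ^ 2 + 2 * M * a * b + N * b ^ 2) ^ 2 + (L * a * c + M * (a * d + b * c) + N * b * d) ^ 2
  = (M ^ 2 - L * N) / (E * G - F ^ 2).
Proof.
intros H1 H2 H3 H4.
destruct (orthonormal_inverse E F G a b c d H1 H2 H3) as [HD [HG [HF HE]]].
set (D := E * G - F ^ 2) in *.
assert (nz : D <> 0) by (intros Z; rewrite Z in HD; lra).
assert (Tr : L * c ^ 2 + 2 * M * c * d + N * d ^ 2 = - (L * a ^ 2 + 2 * M * a * b + N * b ^ 2)).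
{ apply Rmult_eq_reg_l with D; [|exact nz].
  apply Rminus_diag_uniq.
  transitivity (L * (D * (a ^ 2 + c ^ 2)) + 2 * M * (D * (a * b + c * d)) + N * (D * (b ^ 2 + d ^ 2)));
    [ring|rewrite HG, HF, HE; lra]. }
split; [exact Tr|].
transitivity ((a * d - b * c) ^ 2 * D * ((M ^ 2 - L * N) / D)); [|rewrite HD; ring].
transitivity ((L * a * c + M * (a * d + b * c) + N * b * d) ^ 2
  - (L * a ^ 2 + 2 * M * a * b + N * b ^ 2) * (L * c ^ 2 + 2 * M * c * d + N * d ^ 2));
  [rewrite Tr; ring | field; exact nz].
Qed.

(** * The overdetermined system for the curvatures *)

Lemma smooth_on_subset (U V : R -> R -> Prop) f :
  (forall u v, V u v -> U u v) -> smooth_on U f -> smooth_on V f.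
Proof. intros VU Hf ds u v H; apply Hf; now apply VU. Qed.

Lemma open_dom_neq0 U f : open_dom U -> smooth_on U f ->
  open_dom (fun u v => U u v /\ f u v <> 0).
Proof.
intros openU Hf [x y] [Hxy nz]; simpl in *.
apply filter_and; [exact (openU (x, y) Hxy)|].
apply (proj1 (smooth_on_diff U f Hf x y Hxy) (fun r => r <> 0)).
exact (open_neq 0 _ nz).
Qed.

Section Overdetermined.

Variable U : R -> R -> Prop.
Variables a b c d p q kap om W : R -> R -> R.
Variable C : R.
Hypothesis openU : open_dom U.
Hypotheses (Sp : smooth_on U p) (Sq : smooth_on U q) (Sk : smooth_on U kap)
  (So : smooth_on U om) (SW : smooth_on U W).
Hypothesis HW : forall u v, U u v -> W u v = p u v * p u v + q u v * q u v.
Hypothesis comm : forall u v, U u v ->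
  Dir a b (Dir c d W) u v - Dir c d (Dir a b W) u v =
  - kap u v * Dir a b W u v - om u v * Dir c d W u v.
Hypothesis codazzi1 : forall u v, U u v ->
  Dir a b q u v - Dir c d p u v = - 2 * (kap u v * p u v + om u v * q u v).
Hypothesis codazzi2 : forall u v, U u v ->
  Dir a b p u v + Dir c d q u v = 2 * (kap u v * q u v - om u v * p u v).
Hypothesis gauss : forall u v, U u v ->
  Dir a b om u v - Dir c d kap u v = - kap u v ^ 2 - om u v ^ 2 + W u v - 1.
Hypothesis circle1 : forall u v, U u v -> Dir a b kap u v = p u v * q u v.
Hypothesis circle2 : forall u v, U u v -> Dir a b p u v = - kap u v * q u v.
Hypothesis HC : 0 < C < 1.
Hypothesis angle : forall u v, U u v -> p u v * p u v = C * W u v.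

(** The non-umbilic points. In this section [Dir a b] and [Dir c d] stand for differentiation along
    T and B, and [C] for cos(2 theta)^2. Since [V] is open, identities valid only on it may be
    differentiated. *)
Let V u v := U u v /\ W u v <> 0.

Let openV : open_dom V.
Proof. exact (open_dom_neq0 U W openU SW). Qed.

Let VU : forall u v, V u v -> U u v.
Proof. intros u v H; apply H. Qed.

Let Vp : smooth_on V p. Proof. now apply (smooth_on_subset U). Qed.
Let Vq : smooth_on V q. Proof. now apply (smooth_on_subset U). Qed.
Let Vk : smooth_on V kap. Proof. now apply (smooth_on_subset U). Qed.
Let Vo : smooth_on V om. Proof. now apply (smooth_on_subset U). Qed.
Let VW : smooth_on V W. Proof. now apply (smooth_on_subset U). Qed.

(** Both come from differentiating p^2 = C W and q^2 = (1 - C) W along an arbitrary direction.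
    Nothing is divided, so they also hold at umbilics. *)
Lemma frame_derivatives_pq x y u v : U u v ->
  2 * (p u v * Dir x y p u v) = C * Dir x y W u v /\
  2 * (q u v * Dir x y q u v) = (1 - C) * Dir x y W u v.
Proof.
intros H.
pose proof (Dir_ext U openU x y _ _ u v angle H) as E1.
pose proof (Dir_ext U openU x y _ _ u v HW H) as E2.
rewrite (Dir_mult U x y p p), (Dir_mult U x y (fun _ _ => C) W), Dir_const in E1; auto.
2: now apply smooth_on_const.
rewrite (Dir_plus U x y (fun u v => p u v * p u v) (fun u v => q u v * q u v)),
  (Dir_mult U x y p p), (Dir_mult U x y q q) in E2; auto using smooth_on_mult.
split; lra.
Qed.

(** C = 0 would be the bisecting angle and C = 1 the principal one; excluding both keeps C W and (1
    - C) W away from 0. *)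
Lemma pq_neq0 u v : V u v -> p u v <> 0 /\ q u v <> 0.
Proof.
intros [H nz]; pose proof (angle u v H) as E1; pose proof (HW u v H) as E2.
assert (CW : C * W u v <> 0) by (apply Rmult_integral_contrapositive; lra).
assert (CW' : (1 - C) * W u v <> 0) by (apply Rmult_integral_contrapositive; lra).
split; intros Z; rewrite Z in *; lra.
Qed.

(** Inserting the derivatives of p and q into the Codazzi equations gives a linear system for (T W,
    B W) with matrix (Q, -P; P, Q), whose determinant is P^2 + Q^2 = W. The constant C cancels
    because it enters only through P^2 and Q^2. *)
Lemma conformal_factor u v : V u v ->
  Dir a b W u v = - 4 * (W u v * om u v) /\ Dir c d W u v = 4 * (W u v * kap u v).
Proof.
intros HV; destruct (pq_neq0 u v HV) as [np nq]; destruct HV as [H nz].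
destruct (frame_derivatives_pq a b u v H) as [Tp Tq].
destruct (frame_derivatives_pq c d u v H) as [Bp Bq].
pose proof (codazzi1 u v H) as C1; pose proof (codazzi2 u v H) as C2.
pose proof (angle u v H) as E1; pose proof (HW u v H) as E2.
set (w := W u v) in *; set (P := p u v) in *; set (Q := q u v) in *.
set (k := kap u v) in *; set (o := om u v) in *.
set (TW := Dir a b W u v) in *; set (BW := Dir c d W u v) in *.
assert (E3 : Q * Q = (1 - C) * w) by lra.
assert (F1 : Q * TW - P * BW = - 4 * w * (k * P + o * Q)).
{ apply Rmult_eq_reg_l with (P * Q); [|now apply Rmult_integral_contrapositive].
  transitivity ((Q * Q) * P * TW - (P * P) * Q * BW); [ring|rewrite E1, E3].
  transitivity (w * (P * ((1 - C) * TW) - Q * (C * BW))); [ring|rewrite <- Tq, <- Bp].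
  transitivity (2 * w * P * Q * (Dir a b q u v - Dir c d p u v)); [ring|rewrite C1; ring]. }
assert (F2 : P * TW + Q * BW = 4 * w * (k * Q - o * P)).
{ apply Rmult_eq_reg_l with (P * Q); [|now apply Rmult_integral_contrapositive].
  transitivity ((P * P) * Q * TW + (Q * Q) * P * BW); [ring|rewrite E1, E3].
  transitivity (w * (Q * (C * TW) + P * ((1 - C) * BW))); [ring|rewrite <- Tp, <- Bq].
  transitivity (2 * w * P * Q * (Dir a b p u v + Dir c d q u v)); [ring|rewrite C2; ring]. }
split; apply Rmult_eq_reg_l with w; auto; rewrite E2 at 1.
- transitivity (P * (P * TW + Q * BW) + Q * (Q * TW - P * BW)); [ring|].
  rewrite F1, F2, E2; ring.
- transitivity (Q * (P * TW + Q * BW) - P * (Q * TW - P * BW)); [ring|].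
  rewrite F1, F2, E2; ring.
Qed.

(** Up to sign, p and q are constant multiples of the root of W, so their logarithmic derivatives
    are half that of W. The last relation compares the resulting T p with the one from the circle
    condition. *)
Lemma log_derivatives u v : V u v ->
  Dir a b p u v = - 2 * p u v * om u v /\ Dir a b q u v = - 2 * q u v * om u v /\
  Dir c d p u v = 2 * p u v * kap u v /\ Dir c d q u v = 2 * q u v * kap u v /\
  kap u v * q u v = 2 * (p u v * om u v).
Proof.
intros HV; destruct (pq_neq0 u v HV) as [np nq].
destruct (conformal_factor u v HV) as [TW BW]; destruct HV as [H nz].
destruct (frame_derivatives_pq a b u v H) as [Tp Tq].
destruct (frame_derivatives_pq c d u v H) as [Bp Bq].
pose proof (circle2 u v H) as E3.
pose proof (angle u v H) as E1; pose proof (HW u v H) as E2.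
rewrite TW in Tp, Tq; rewrite BW in Bp, Bq.
assert (E4 : q u v * q u v = (1 - C) * W u v) by lra.
assert (half : forall P D c s o, P <> 0 -> P * P = c * W u v ->
  2 * (P * D) = c * (s * (W u v * o)) -> 2 * D = s * (P * o)).
{ intros P D c' s o nP EP ED; apply Rmult_eq_reg_l with P; [|exact nP].
  transitivity (s * o * (c' * W u v)); [lra|rewrite <- EP; ring]. }
pose proof (half _ _ _ _ _ np E1 Tp); pose proof (half _ _ _ _ _ nq E4 Tq).
pose proof (half _ _ _ _ _ np E1 Bp); pose proof (half _ _ _ _ _ nq E4 Bq).
repeat split; lra.
Qed.

Lemma Dir_kap_om x y u v : V u v ->
  Dir x y kap u v * q u v + kap u v * Dir x y q u v =
  2 * (Dir x y p u v * om u v + p u v * Dir x y om u v).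
Proof.
intros HV.
assert (E : forall u v, V u v -> kap u v * q u v = 2 * (p u v * om u v)).
{ intros; now apply log_derivatives. }
pose proof (Dir_ext V openV x y _ _ u v E HV) as D.
rewrite (Dir_mult V x y kap q), (Dir_mult V x y (fun _ _ => 2) (fun u v => p u v * om u v)),
  Dir_const, (Dir_mult V x y p om) in D; auto using smooth_on_mult, smooth_on_const.
lra.
Qed.

(** By [conformal_factor] the pair (T W, B W) is proportional to (- om, kap), so kap T W + om B W =
    0. This kills the bracket term as well as the terms of the product rule in which W is
    differentiated. *)
Lemma connection_harmonic u v : V u v -> Dir a b kap u v + Dir c d om u v = 0.
Proof.
intros HV; destruct (conformal_factor u v HV) as [TW BW].
pose proof (comm u v (VU u v HV)) as E.
rewrite (Dir_ext V openV a b (Dir c d W) (fun u v => 4 * (W u v * kap u v))) in E; auto;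
  [|intros; now apply conformal_factor].
rewrite (Dir_ext V openV c d (Dir a b W) (fun u v => - 4 * (W u v * om u v))) in E; auto;
  [|intros; now apply conformal_factor].
rewrite (Dir_mult V a b (fun _ _ => 4) (fun u v => W u v * kap u v)),
  (Dir_mult V c d (fun _ _ => - 4) (fun u v => W u v * om u v)), !Dir_const,
  (Dir_mult V a b W kap), (Dir_mult V c d W om) in E; auto using smooth_on_mult, smooth_on_const.
rewrite TW, BW in E; destruct HV as [_ nz].
apply Rmult_eq_reg_l with (4 * W u v); [|lra]; lra.
Qed.

(** T kap = p q is the circle condition, and [connection_harmonic] turns it into B om = - p q.
    Differentiating kap q = 2 p om along T and along B then gives the other two derivatives, after
    division by p and by q respectively. *)
Lemma connection_derivatives u v : V u v ->
  Dir a b om u v = / 2 * (q u v * q u v) /\ Dir c d kap u v = - 2 * (p u v * p u v).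
Proof.
intros HV; destruct (pq_neq0 u v HV) as [np nq].
destruct (log_derivatives u v HV) as [ap [aq [bp [bq kq]]]].
pose proof (Dir_kap_om a b u v HV) as Ea; pose proof (Dir_kap_om c d u v HV) as Eb.
pose proof (connection_harmonic u v HV) as H.
pose proof (circle1 u v (VU u v HV)) as ak.
rewrite ap, aq, ak in Ea; rewrite bp, bq in Eb.
assert (bo : Dir c d om u v = - (p u v * q u v)) by lra.
rewrite bo in Eb.
split.
- apply Rmult_eq_reg_l with (2 * p u v); [|lra].
  transitivity (p u v * q u v * q u v - 2 * om u v * (kap u v * q u v - 2 * (p u v * om u v)));
    [lra|rewrite kq; field].
- apply Rmult_eq_reg_l with (q u v); [|exact nq].
  transitivity (- 2 * (p u v * p u v) * q u v
    - 2 * kap u v * (kap u v * q u v - 2 * (p u v * om u v))); [lra|rewrite kq; ring].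
Qed.

Lemma reduced_gauss u v : V u v ->
  - / 2 * (q u v * q u v) + p u v * p u v + (kap u v * kap u v + om u v * om u v) = -1.
Proof.
intros HV; destruct (connection_derivatives u v HV) as [ao bk].
pose proof (gauss u v (VU u v HV)) as E; rewrite ao, bk, (HW u v (VU u v HV)) in E; lra.
Qed.

Lemma connection_eq0 u v : V u v -> om u v = 0 /\ kap u v = 0.
Proof.
intros HV; destruct (pq_neq0 u v HV) as [np nq].
destruct (log_derivatives u v HV) as [ap [aq [_ [_ kq]]]].
destruct (connection_derivatives u v HV) as [ao _].
pose proof (circle1 u v (VU u v HV)) as ak.
pose proof (Dir_ext V openV a b _ _ u v reduced_gauss HV) as D.
rewrite (Dir_plus V a b (fun u v => - / 2 * (q u v * q u v) + p u v * p u v)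
    (fun u v => kap u v * kap u v + om u v * om u v)),
  (Dir_plus V a b (fun u v => - / 2 * (q u v * q u v)) (fun u v => p u v * p u v)),
  (Dir_plus V a b (fun u v => kap u v * kap u v) (fun u v => om u v * om u v)),
  (Dir_mult V a b (fun _ _ => - / 2) (fun u v => q u v * q u v)),
  (Dir_mult V a b q q), (Dir_mult V a b p p), (Dir_mult V a b kap kap), (Dir_mult V a b om om),
  !Dir_const in D; auto 7 using smooth_on_plus, smooth_on_mult, smooth_on_const.
rewrite ap, aq, ao, ak in D.
(* The contributions of p^2 and kap^2 are - 4 p^2 om and 2 p q kap = 4 p^2 om and cancel. The factor
   3 is 2 from - q^2 / 2 plus 1 from om^2. *)
assert (E : om u v * (3 * (q u v * q u v)) = 0).
{ transitivity (2 * p u v * (2 * (p u v * om u v)) - 4 * p u v * p u v * om u v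
   + 3 * (q u v * q u v) * om u v); [ring|rewrite <- kq]; lra. }
assert (nqq : q u v * q u v <> 0) by now apply Rmult_integral_contrapositive.
assert (o0 : om u v = 0).
{ apply Rmult_integral in E; destruct E as [E|E]; [exact E|lra]. }
split; [exact o0|].
rewrite o0 in kq; apply Rmult_eq_reg_r with (q u v); [lra|exact nq].
Qed.

(** At an umbilic p = 0, and 2 p Dp = C DW with C nonzero forces DW = 0; elsewhere DW is a multiple
    of om or kap. *)
Lemma Dir_W_eq0 u v : U u v -> Dir a b W u v = 0 /\ Dir c d W u v = 0.
Proof.
intros H; destruct (Req_dec (W u v) 0) as [Z|nz].
- pose proof (HW u v H) as E.
  assert (p0 : p u v = 0) by nra; assert (q0 : q u v = 0) by nra.
  destruct (frame_derivatives_pq a b u v H) as [Tp _].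
  destruct (frame_derivatives_pq c d u v H) as [Bp _].
  rewrite p0 in Tp, Bp; split; apply Rmult_eq_reg_l with C; lra.
- destruct (conformal_factor u v (conj H nz)) as [TW BW].
  destruct (connection_eq0 u v (conj H nz)) as [o0 k0].
  rewrite TW, BW, o0, k0; split; ring.
Qed.

End Overdetermined.

(** * Partial derivatives of inner products *)

Lemma dot_ext x x' y y' : (forall i, (i < 4)%nat -> x i = x' i) ->
  (forall i, (i < 4)%nat -> y i = y' i) -> dot x y = dot x' y'.
Proof. intros Hx Hy; unfold dot; rewrite !Hx, !Hy by lia; reflexivity. Qed.

Section Dot_partials.

Variable U : R -> R -> Prop.
Hypothesis openU : open_dom U.

Lemma Du_dot V W u v : smooth_vec U V -> smooth_vec U W -> U u v ->
  Du (fun x y => dot (V x y) (W x y)) u v = dot (VDu V u v) (W u v) + dot (V u v) (VDu W u v).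
Proof.
intros HV HW H.
generalize (Dir_dot U openU (fun _ _ => 1) (fun _ _ => 0) V W u v HV HW H).
unfold VDir, Dir, dot, VDu; intros E; ring_simplify in E; ring_simplify; exact E.
Qed.

Lemma Dv_dot V W u v : smooth_vec U V -> smooth_vec U W -> U u v ->
  Dv (fun x y => dot (V x y) (W x y)) u v = dot (VDv V u v) (W u v) + dot (V u v) (VDv W u v).
Proof.
intros HV HW H.
generalize (Dir_dot U openU (fun _ _ => 0) (fun _ _ => 1) V W u v HV HW H).
unfold VDir, Dir, dot, VDv; intros E; ring_simplify in E; ring_simplify; exact E.
Qed.

Lemma smooth_vec_VDu V : smooth_vec U V -> smooth_vec U (VDu V).
Proof. intros H i Hi; exact (smooth_on_Du U _ (H i Hi)). Qed.

Lemma smooth_vec_VDv V : smooth_vec U V -> smooth_vec U (VDv V).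
Proof. intros H i Hi; exact (smooth_on_Dv U _ (H i Hi)). Qed.

Lemma VDu_VDv V u v i : smooth_vec U V -> U u v -> (i < 4)%nat ->
  VDu (VDv V) u v i = VDv (VDu V) u v i.
Proof. intros HV H Hi; exact (Du_Dv_comm U openU _ u v (HV i Hi) H). Qed.

End Dot_partials.

(** * Orthonormal frames on a minimal surface in S^3 *)

Section Frame.

Variable U : R -> R -> Prop.
Variables l n : R -> R -> vec.
Variables a b c d : R -> R -> R.
Hypothesis openU : open_dom U.
Hypothesis minimal : minimal_surface_S3 U l n.
Hypotheses (Sa : smooth_on U a) (Sb : smooth_on U b) (Sc : smooth_on U c) (Sd : smooth_on U d).
Hypothesis unitT : forall u v, U u v ->
  fE l u v * a u v ^ 2 + 2 * fF l u v * a u v * b u v + fG l u v * b u v ^ 2 = 1.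
Hypothesis unitB : forall u v, U u v ->
  fE l u v * c u v ^ 2 + 2 * fF l u v * c u v * d u v + fG l u v * d u v ^ 2 = 1.
Hypothesis orthTB : forall u v, U u v ->
  fE l u v * a u v * c u v + fF l u v * (a u v * d u v + b u v * c u v)
  + fG l u v * b u v * d u v = 0.

(** At this stage T, B is any smooth orthonormal tangent frame; the circles enter later. As B is
    tangent, [kap] and [om] may be read off from the flat derivative: its B component is that of the
    Levi-Civita connection. *)
Let T := VDir a b l.
Let B := VDir c d l.
Let p u v := dot (VDir a b T u v) (n u v).
Let q u v := dot (VDir c d T u v) (n u v).
Let kap u v := dot (VDir a b T u v) (B u v).
Let om u v := dot (VDir c d T u v) (B u v).
Let W u v := p u v ^ 2 + q u v ^ 2.

Let Sl : smooth_vec U l. Proof. apply minimal. Qed.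
Let Sn : smooth_vec U n. Proof. apply minimal. Qed.
Let ST : smooth_vec U T. Proof. now apply smooth_vec_VDir. Qed.
Let SB : smooth_vec U B. Proof. now apply smooth_vec_VDir. Qed.

Lemma first_form_frame u v : U u v ->
  let D := fE l u v * fG l u v - fF l u v ^ 2 in
  (a u v * d u v - b u v * c u v) ^ 2 * D = 1 /\ D <> 0.
Proof.
intros H D.
destruct (orthonormal_inverse _ _ _ _ _ _ _ (unitT u v H) (unitB u v H) (orthTB u v H)) as [HD _].
split; [exact HD|]; intros Z; fold D in HD; rewrite Z in HD; lra.
Qed.

Lemma tangent_orthogonal u v : U u v ->
  dot (VDu l u v) (n u v) = 0 /\ dot (VDv l u v) (n u v) = 0 /\
  dot (VDu l u v) (l u v) = 0 /\ dot (VDv l u v) (l u v) = 0.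
Proof.
intros H; destruct minimal as [_ [_ [ll [_ [nn _]]]]].
destruct (nn u v H) as [_ [_ [nu nv]]].
rewrite !(dot_comm _ (n u v)); repeat split; auto.
- assert (E : Du (fun x y => dot (l x y) (l x y)) u v = 0).
  { rewrite (Du_ext U openU _ (fun _ _ => 1) ll u v H); apply (Derive_const 1). }
  rewrite (Du_dot U openU l l u v Sl Sl H), (dot_comm (l u v)) in E; lra.
- assert (E : Dv (fun x y => dot (l x y) (l x y)) u v = 0).
  { rewrite (Dv_ext U openU _ (fun _ _ => 1) ll u v H); apply (Derive_const 1). }
  rewrite (Dv_dot U openU l l u v Sl Sl H), (dot_comm (l u v)) in E; lra.
Qed.

Lemma frame_orthonormal u v : U u v ->
  dot (T u v) (T u v) = 1 /\ dot (B u v) (B u v) = 1 /\ dot (n u v) (n u v) = 1 /\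
  dot (l u v) (l u v) = 1 /\ dot (T u v) (B u v) = 0 /\ dot (T u v) (n u v) = 0 /\
  dot (T u v) (l u v) = 0 /\ dot (B u v) (n u v) = 0 /\ dot (B u v) (l u v) = 0 /\
  dot (n u v) (l u v) = 0.
Proof.
intros H; destruct minimal as [_ [_ [ll [_ [nn _]]]]].
destruct (nn u v H) as [n1 [nl [nu nv]]].
destruct (tangent_orthogonal u v H) as [_ [_ [lu lv]]].
assert (dT : forall z, dot (T u v) z = a u v * dot (VDu l u v) z + b u v * dot (VDv l u v) z).
{ intros z; apply dot_lin_l; reflexivity. }
assert (dB : forall z, dot (B u v) z = c u v * dot (VDu l u v) z + d u v * dot (VDv l u v) z).
{ intros z; apply dot_lin_l; reflexivity. }
pose proof (unitT u v H) as hT; pose proof (unitB u v H) as hB; pose proof (orthTB u v H) as hTB.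
unfold fE, fF, fG in hT, hB, hTB.
repeat split; auto; rewrite ?dT, ?dB.
- rewrite !(dot_comm _ (T u v)), !dT, (dot_comm (VDv l u v) (VDu l u v)); lra.
- rewrite !(dot_comm _ (B u v)), !dB, (dot_comm (VDv l u v) (VDu l u v)); lra.
- rewrite !(dot_comm _ (B u v)), !dB, (dot_comm (VDv l u v) (VDu l u v)); lra.
- rewrite !(dot_comm _ (n u v)), nu, nv; ring.
- rewrite lu, lv; ring.
- rewrite !(dot_comm _ (n u v)), nu, nv; ring.
- rewrite lu, lv; ring.
Qed.

Lemma frame_parseval u v x y : U u v ->
  dot x y = dot x (T u v) * dot y (T u v) + dot x (B u v) * dot y (B u v)
    + dot x (n u v) * dot y (n u v) + dot x (l u v) * dot y (l u v).
Proof. intros H; apply parseval; apply frame_orthonormal, H. Qed.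

(** Row and column operations with l_u and l_v remove the tangential parts of x and y, so the
    determinant is that of the first form times the inner product of the parts along n and l. *)
Lemma gram_det u v x y : U u v ->
  det3 (dot x y) (dot x (VDu l u v)) (dot x (VDv l u v))
       (dot y (VDu l u v)) (fE l u v) (fF l u v)
       (dot y (VDv l u v)) (fF l u v) (fG l u v)
  = (fE l u v * fG l u v - fF l u v ^ 2)
    * (dot x (n u v) * dot y (n u v) + dot x (l u v) * dot y (l u v)).
Proof.
intros H; destruct (tangent_orthogonal u v H) as [un [vn [ul vl]]].
unfold fE, fF, fG.
rewrite (frame_parseval u v x y H), (frame_parseval u v x (VDu l u v) H),
  (frame_parseval u v x (VDv l u v) H), (frame_parseval u v y (VDu l u v) H),
  (frame_parseval u v y (VDv l u v) H), (frame_parseval u v (VDu l u v) (VDu l u v) H),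
  (frame_parseval u v (VDu l u v) (VDv l u v) H), (frame_parseval u v (VDv l u v) (VDv l u v) H).
rewrite un, vn, ul, vl; unfold det3; ring.
Qed.


(* The third derivatives of [l] cancel in Brioschi's formula, which leaves the difference of two
   Gram determinants computed by [gram_det]. *)
Lemma gauss_equation u v : U u v ->
  gauss_curv l u v =
  1 + (sL l n u v * sN l n u v - sM l n u v ^ 2) / (fE l u v * fG l u v - fF l u v ^ 2).
Proof.
intros H.
assert (Su := smooth_vec_VDu U l Sl); assert (Sv := smooth_vec_VDv U l Sl).
assert (Suu := smooth_vec_VDu U _ Su); assert (Suv := smooth_vec_VDv U _ Su).
assert (vu : forall u v z, U u v -> dot (VDu (VDv l) u v) z = dot (VDv (VDu l) u v) z).
{ intros u' v' z H'; apply dot_ext; [|reflexivity].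
  intros i Hi; exact (VDu_VDv U openU l u' v' i Sl H' Hi). }
assert (Eu : forall u v, U u v -> Du (fE l) u v = 2 * dot (VDu (VDu l) u v) (VDu l u v)).
{ intros u' v' H'; unfold fE; rewrite (Du_dot U openU _ _ _ _ Su Su H').
  rewrite (dot_comm (VDu l u' v')); ring. }
assert (Ev : forall u v, U u v -> Dv (fE l) u v = 2 * dot (VDv (VDu l) u v) (VDu l u v)).
{ intros u' v' H'; unfold fE; rewrite (Dv_dot U openU _ _ _ _ Su Su H').
  rewrite (dot_comm (VDu l u' v')); ring. }
assert (Fu : forall u v, U u v -> Du (fF l) u v =
  dot (VDu (VDu l) u v) (VDv l u v) + dot (VDv (VDu l) u v) (VDu l u v)).
{ intros u' v' H'; unfold fF; rewrite (Du_dot U openU _ _ _ _ Su Sv H').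
  rewrite (dot_comm (VDu l u' v')), vu by exact H'; ring. }
assert (Fv : forall u v, U u v -> Dv (fF l) u v =
  dot (VDv (VDu l) u v) (VDv l u v) + dot (VDv (VDv l) u v) (VDu l u v)).
{ intros u' v' H'; unfold fF; rewrite (Dv_dot U openU _ _ _ _ Su Sv H').
  rewrite (dot_comm (VDu l u' v')); ring. }
assert (Gu : forall u v, U u v -> Du (fG l) u v = 2 * dot (VDv (VDu l) u v) (VDv l u v)).
{ intros u' v' H'; unfold fG; rewrite (Du_dot U openU _ _ _ _ Sv Sv H').
  rewrite (dot_comm (VDv l u' v')), vu by exact H'; ring. }
assert (Gv : forall u v, U u v -> Dv (fG l) u v = 2 * dot (VDv (VDv l) u v) (VDv l u v)).
{ intros u' v' H'; unfold fG; rewrite (Dv_dot U openU _ _ _ _ Sv Sv H').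
  rewrite (dot_comm (VDv l u' v')); ring. }
assert (Evv : Dv (Dv (fE l)) u v =
  2 * (dot (VDv (VDv (VDu l)) u v) (VDu l u v) + dot (VDv (VDu l) u v) (VDv (VDu l) u v))).
{ rewrite (Dv_ext U openU _ _ Ev u v H), (Dv_mult U (fun _ _ => 2) _ u v);
    [|now apply smooth_on_diff, smooth_on_const|now apply smooth_on_diff, smooth_on_dot|exact H].
  rewrite (Dv_dot U openU _ _ _ _ Suv Su H).
  replace (Dv (fun _ _ => 2) u v) with 0 by (symmetry; apply (Derive_const 2)); ring. }
assert (Guu : Du (Du (fG l)) u v =
  2 * (dot (VDu (VDv (VDu l)) u v) (VDv l u v) + dot (VDv (VDu l) u v) (VDv (VDu l) u v))).
{ rewrite (Du_ext U openU _ _ Gu u v H), (Du_mult U (fun _ _ => 2) _ u v);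
    [|now apply smooth_on_diff, smooth_on_const|now apply smooth_on_diff, smooth_on_dot|exact H].
  rewrite (Du_dot U openU _ _ _ _ Suv Sv H), (dot_comm _ (VDu (VDv l) u v)), vu by exact H.
  replace (Du (fun _ _ => 2) u v) with 0 by (symmetry; apply (Derive_const 2)); ring. }
assert (Fuv : Dv (Du (fF l)) u v =
  dot (VDu (VDv (VDu l)) u v) (VDv l u v) + dot (VDu (VDu l) u v) (VDv (VDv l) u v)
  + (dot (VDv (VDv (VDu l)) u v) (VDu l u v) + dot (VDv (VDu l) u v) (VDv (VDu l) u v))).
{ rewrite (Dv_ext U openU _ _ Fu u v H), (Dv_plus U);
    [|now apply smooth_on_diff, smooth_on_dot|now apply smooth_on_diff, smooth_on_dot|exact H].
  rewrite (Dv_dot U openU _ _ _ _ Suu Sv H), (Dv_dot U openU _ _ _ _ Suv Su H).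
  do 2 f_equal; apply dot_ext; [|reflexivity].
  intros i Hi; symmetry; exact (VDu_VDv U openU _ u v i Su H Hi). }
(* The components of l_uu, l_uv, l_vv along l are -E, -F, -G. In the Gram determinants they produce
   E G - F^2, which is the summand 1 of the Gauss equation, the curvature of the sphere. *)
assert (nl : forall V, smooth_vec U V -> (forall u v, U u v -> dot (V u v) (l u v) = 0) ->
  dot (VDu V u v) (l u v) = - dot (V u v) (VDu l u v) /\
  dot (VDv V u v) (l u v) = - dot (V u v) (VDv l u v)).
{ intros V SV HV; split.
  - assert (E : Du (fun x y => dot (V x y) (l x y)) u v = 0).
    { rewrite (Du_ext U openU _ (fun _ _ => 0) HV u v H); apply (Derive_const 0). }
    rewrite (Du_dot U openU _ _ _ _ SV Sl H) in E; lra.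
  - assert (E : Dv (fun x y => dot (V x y) (l x y)) u v = 0).
    { rewrite (Dv_ext U openU _ (fun _ _ => 0) HV u v H); apply (Derive_const 0). }
    rewrite (Dv_dot U openU _ _ _ _ SV Sl H) in E; lra. }
destruct (nl _ Su (fun u v H => proj1 (proj2 (proj2 (tangent_orthogonal u v H))))) as [uul uvl].
destruct (nl _ Sv (fun u v H => proj2 (proj2 (proj2 (tangent_orthogonal u v H))))) as [_ vvl].
pose proof (gram_det u v (VDu (VDu l) u v) (VDv (VDv l) u v) H) as G1.
pose proof (gram_det u v (VDv (VDu l) u v) (VDv (VDu l) u v) H) as G2.
rewrite uul, vvl in G1; rewrite uvl in G2.
destruct (first_form_frame u v H) as [_ nz].
unfold gauss_curv; rewrite Evv, Guu, Fuv, Eu, Ev, Fu, Fv, Gu, Gv by exact H.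
fold (sL l n u v) (sN l n u v) in G1; fold (sM l n u v) in G2.
fold (fE l u v) (fG l u v) in G1; fold (fF l u v) in G2.
apply Rmult_eq_reg_l with ((fE l u v * fG l u v - fF l u v ^ 2) ^ 2); [|now apply pow_nonzero].
match goal with |- _ = ?r => transitivity
  ((fE l u v * fG l u v - fF l u v ^ 2)
    * (sL l n u v * sN l n u v + - fE l u v * - fG l u v)
  - (fE l u v * fG l u v - fF l u v ^ 2)
    * (sM l n u v * sM l n u v + - fF l u v * - fF l u v)) end; [|field; exact nz].
rewrite <- G1, <- G2.
unfold det3; field; exact nz.
Qed.

(** Derivatives of the coefficients z, w only multiply l_u and l_v, which n annihilates; the rest is
    the tensor II at (x, y) and (z, w). *)
Lemma second_derivative_normal x y z w u v :
  smooth_on U z -> smooth_on U w -> U u v ->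
  dot (VDir x y (VDir z w l) u v) (n u v) =
  sL l n u v * (x u v * z u v) + sM l n u v * (x u v * w u v + y u v * z u v)
  + sN l n u v * (y u v * w u v).
Proof.
intros Hz Hw H.
assert (Su := smooth_vec_VDu U l Sl); assert (Sv := smooth_vec_VDv U l Sl).
destruct (tangent_orthogonal u v H) as [un [vn _]].
assert (E : forall i, (i < 4)%nat -> VDir x y (VDir z w l) u v i =
  Dir x y z u v * VDu l u v i + Dir x y w u v * VDv l u v i
  + (x u v * z u v * VDu (VDu l) u v i
     + (x u v * w u v + y u v * z u v) * VDv (VDu l) u v i
     + y u v * w u v * VDv (VDv l) u v i)).
{ intros i Hi; rewrite <- (VDu_VDv U openU l u v i Sl H Hi) at 1.
  unfold VDir at 1.
  change (fun x0 y0 => VDir z w l x0 y0 i) with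
    (fun u v => z u v * VDu l u v i + w u v * VDv l u v i).
  rewrite (Dir_plus U x y (fun u v => z u v * VDu l u v i) (fun u v => w u v * VDv l u v i));
    auto; try (apply smooth_on_mult; auto).
  rewrite !(Dir_mult U) by auto.
  pose proof (VDu_VDv U openU l u v i Sl H Hi) as C.
  unfold Dir, VDu, VDv in *; rewrite C; ring. }
unfold sL, sM, sN; revert un vn; unfold dot; rewrite !E by lia; intros un vn.
(* Subtracts multiples of <l_u, n> and <l_v, n>, both zero, in expanded form, which leaves a
   polynomial identity. *)
match goal with |- ?g = _ => match type of un with ?e1 = _ => match type of vn with ?e2 = _ =>
  transitivity (g - Dir x y z u v * e1 - Dir x y w u v * e2) end end end;
  [rewrite un, vn; ring | ring].
Qed.

Lemma trace_zero u v : U u v ->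
  fE l u v * sN l n u v - 2 * fF l u v * sM l n u v + fG l u v * sL l n u v = 0.
Proof.
intros H; destruct minimal as [_ [_ [_ [_ [_ mean]]]]].
destruct (first_form_frame u v H) as [_ nz].
pose proof (mean u v H) as E; unfold mean_curv in E.
apply Rmult_eq_reg_r with (/ (2 * (fE l u v * fG l u v - fF l u v ^ 2)));
  [rewrite Rmult_0_l; exact E | apply Rinv_neq_0_compat; lra].
Qed.

(** Minimality gives II(B,B) = - II(T,T), symmetry gives II(B,T) = II(T,B), and det II = - W enters
    the Gauss equation. *)
Lemma second_form_frame u v : U u v ->
  dot (VDir c d B u v) (n u v) = - p u v /\ dot (VDir a b B u v) (n u v) = q u v /\
  gauss_curv l u v = 1 - W u v.
Proof.
intros H; destruct (first_form_frame u v H) as [HD nz].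
pose proof (trace_zero u v H) as tr.
destruct (traceless_form _ _ _ _ _ _ _ _ _ _ (unitT u v H) (unitB u v H) (orthTB u v H) tr)
  as [E1 E2].
rewrite (gauss_equation u v H); unfold W, p, q, T, B.
rewrite !second_derivative_normal by assumption.
repeat split.
- match type of E1 with ?x = - ?y => transitivity x; [ring | rewrite E1; ring] end.
- ring.
- match type of E2 with ?x = ?y => assert (E3 : x = y) by exact E2 end.
  match goal with |- _ = 1 - ?r => match type of E3 with ?x = _ =>
    replace r with x by ring end end.
  rewrite E3; field; exact nz.
Qed.


(** The connection matrix of the orthonormal frame T, B, n, l is skew, because inner products of
    frame vectors are constant. The entries -1 arise from D_T l = T and D_B l = B. *)
Lemma structure_equations u v : U u v ->
  (dot (VDir a b T u v) (T u v) = 0 /\ dot (VDir c d T u v) (T u v) = 0 /\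
   dot (VDir a b T u v) (l u v) = -1 /\ dot (VDir c d T u v) (l u v) = 0) /\
  (dot (VDir a b B u v) (T u v) = - kap u v /\ dot (VDir c d B u v) (T u v) = - om u v /\
   dot (VDir a b B u v) (B u v) = 0 /\ dot (VDir c d B u v) (B u v) = 0 /\
   dot (VDir a b B u v) (l u v) = 0 /\ dot (VDir c d B u v) (l u v) = -1) /\
  (dot (VDir a b n u v) (T u v) = - p u v /\ dot (VDir c d n u v) (T u v) = - q u v /\
   dot (VDir a b n u v) (B u v) = - q u v /\ dot (VDir c d n u v) (B u v) = p u v /\
   dot (VDir a b n u v) (n u v) = 0 /\ dot (VDir c d n u v) (n u v) = 0 /\
   dot (VDir a b n u v) (l u v) = 0 /\ dot (VDir c d n u v) (l u v) = 0).
Proof.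
intros H.
assert (K : forall x y V Z k, smooth_vec U V -> smooth_vec U Z ->
  (forall u v, U u v -> dot (V u v) (Z u v) = k) ->
  dot (VDir x y V u v) (Z u v) = - dot (VDir x y Z u v) (V u v)).
{ intros x y V Z k HV HZ HVZ.
  generalize (Dir_dot_const U openU x y V Z k u v HV HZ HVZ H).
  rewrite (dot_comm (V u v)); lra. }
destruct (second_form_frame u v H) as [bBn [aBn _]].
destruct (frame_orthonormal u v H) as [TT [BB [nn [ll [TB [Tn [Tl [Bn [Bl nl]]]]]]]]].
pose proof (fun x y => K x y T T 1 ST ST (fun u v H => proj1 (frame_orthonormal u v H))) as KTT.
pose proof (fun x y => K x y B B 1 SB SB
  (fun u v H => proj1 (proj2 (frame_orthonormal u v H)))) as KBB.
pose proof (fun x y => K x y n n 1 Sn Sn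
  (fun u v H => proj1 (proj2 (proj2 (frame_orthonormal u v H))))) as Knn.
assert (KBT : forall x y, dot (VDir x y B u v) (T u v) = - dot (VDir x y T u v) (B u v)).
{ intros x y; apply (K x y B T 0); auto; intros; rewrite dot_comm; now apply frame_orthonormal. }
assert (KnT : forall x y, dot (VDir x y n u v) (T u v) = - dot (VDir x y T u v) (n u v)).
{ intros x y; apply (K x y n T 0); auto; intros; rewrite dot_comm; now apply frame_orthonormal. }
assert (KnB : forall x y, dot (VDir x y n u v) (B u v) = - dot (VDir x y B u v) (n u v)).
{ intros x y; apply (K x y n B 0); auto; intros; rewrite dot_comm; now apply frame_orthonormal. }
assert (KTl : forall x y, dot (VDir x y T u v) (l u v) = - dot (VDir x y l u v) (T u v)).
{ intros x y; apply (K x y T l 0); auto; intros; now apply frame_orthonormal. }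
assert (KBl : forall x y, dot (VDir x y B u v) (l u v) = - dot (VDir x y l u v) (B u v)).
{ intros x y; apply (K x y B l 0); auto; intros; now apply frame_orthonormal. }
assert (Knl : forall x y, dot (VDir x y n u v) (l u v) = - dot (VDir x y l u v) (n u v)).
{ intros x y; apply (K x y n l 0); auto; intros; now apply frame_orthonormal. }
specialize (KTT a b) as T1; specialize (KTT c d) as T2.
specialize (KBB a b) as B1; specialize (KBB c d) as B2.
specialize (Knn a b) as n1; specialize (Knn c d) as n2.
rewrite !KTl, !KBl, !Knl, !KBT, !KnT, !KnB, aBn, bBn.
fold T B; rewrite (dot_comm (B u v) (T u v)).
fold (kap u v) (om u v) (p u v) (q u v).
repeat split; lra.
Qed.

(** The bracket of T and B has coefficients x1, x2 that do not depend on [f]. Applied to the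
    components of l it gives D_T B - D_B T, whose frame components are known: it equals - kap T - om
    B. *)
Lemma frame_commutator f u v : smooth_on U f -> U u v ->
  Dir a b (Dir c d f) u v - Dir c d (Dir a b f) u v =
  - kap u v * Dir a b f u v - om u v * Dir c d f u v.
Proof.
intros Hf H.
destruct (structure_equations u v H) as [[aTT [bTT _]] [[aBT [bBT [aBB [bBB _]]]] _]].
destruct (frame_orthonormal u v H) as [TT [BB [_ [_ [TB _]]]]].
destruct (tangent_orthogonal u v H) as [un [vn [ul vl]]].
set (x1 := Dir a b c u v - Dir c d a u v); set (x2 := Dir a b d u v - Dir c d b u v).
assert (bracket : forall z, dot (VDir a b B u v) z - dot (VDir c d T u v) z =
  x1 * dot (VDu l u v) z + x2 * dot (VDv l u v) z).
{ assert (E : forall i, (i < 4)%nat -> VDir a b B u v i - VDir c d T u v i =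
    x1 * VDu l u v i + x2 * VDv l u v i).
  { intros i Hi; exact (Dir_comm U openU a b c d _ u v Sa Sb Sc Sd (Sl i Hi) H). }
  intros z; rewrite <- (dot_lin_l x1 x2 _ _ (fun i => VDir a b B u v i - VDir c d T u v i) z E).
  unfold dot; ring. }
pose proof (bracket (T u v)) as b1; pose proof (bracket (B u v)) as b2.
rewrite aBT, bTT in b1; rewrite aBB in b2; fold (om u v) in b2.
(* Z is the bracket plus kap T + om B. It is orthogonal to the whole frame, hence zero, and the
   independence of l_u, l_v passes this to the coefficients. *)
set (Z := fun i => (x1 + kap u v * a u v + om u v * c u v) * VDu l u v i
  + (x2 + kap u v * b u v + om u v * d u v) * VDv l u v i).
assert (dZ : forall z, dot Z z = x1 * dot (VDu l u v) z + x2 * dot (VDv l u v) z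
  + kap u v * dot (T u v) z + om u v * dot (B u v) z).
{ intros z; unfold Z, T, B, VDir, Dir, VDu, VDv, dot; ring. }
assert (ZZ : dot Z Z = 0).
{ assert (ZT : dot Z (T u v) = 0) by (rewrite dZ, (dot_comm (B u v)), TT, TB; lra).
  assert (ZB : dot Z (B u v) = 0) by (rewrite dZ, TB, BB; lra).
  assert (Zn : dot Z (n u v) = 0).
  { rewrite (dot_lin_l _ _ (VDu l u v) (VDv l u v) Z) by reflexivity; rewrite un, vn; ring. }
  assert (Zl : dot Z (l u v) = 0).
  { rewrite (dot_lin_l _ _ (VDu l u v) (VDv l u v) Z) by reflexivity; rewrite ul, vl; ring. }
  rewrite (frame_parseval u v Z Z H), ZT, ZB, Zn, Zl; ring. }
destruct minimal as [_ [_ [_ [indep _]]]].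
destruct (indep u v H _ _ (dot_self_eq0 Z ZZ)) as [e1 e2].
rewrite (Dir_comm U openU a b c d f u v Sa Sb Sc Sd Hf H); fold x1 x2.
replace x1 with (- kap u v * a u v - om u v * c u v) by lra.
replace x2 with (- kap u v * b u v - om u v * d u v) by lra.
unfold Dir; ring.
Qed.

(** Flatness of R^4: the commutator of D_T and D_B on V is the derivative along the bracket of T and
    B. The pairs (T, n) and (B, n) yield the two Codazzi equations, the pair (T, B) the Gauss
    equation. *)
Lemma curvature_dot V Z u v : smooth_vec U V -> smooth_vec U Z -> U u v ->
  Dir a b (fun x y => dot (VDir c d V x y) (Z x y)) u v
  - Dir c d (fun x y => dot (VDir a b V x y) (Z x y)) u v =
  - kap u v * dot (VDir a b V u v) (Z u v) - om u v * dot (VDir c d V u v) (Z u v)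
  + dot (VDir c d V u v) (VDir a b Z u v) - dot (VDir a b V u v) (VDir c d Z u v).
Proof.
intros HV HZ H.
rewrite !(Dir_dot U openU) by (auto; now apply smooth_vec_VDir).
assert (E : dot (VDir a b (VDir c d V) u v) (Z u v) - dot (VDir c d (VDir a b V) u v) (Z u v) =
  - kap u v * dot (VDir a b V u v) (Z u v) - om u v * dot (VDir c d V u v) (Z u v)).
{ transitivity (dot (fun i => VDir a b (VDir c d V) u v i - VDir c d (VDir a b V) u v i) (Z u v));
    [unfold dot; ring|].
  rewrite (dot_lin_l (- kap u v) (- om u v) (VDir a b V u v) (VDir c d V u v)); [ring|].
  intros i Hi; transitivity (- kap u v * VDir a b V u v i - om u v * VDir c d V u v i);
    [exact (frame_commutator _ u v (HV i Hi) H) | ring]. }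
lra.
Qed.

Lemma codazzi_gauss u v : U u v ->
  Dir a b q u v - Dir c d p u v = - 2 * (kap u v * p u v + om u v * q u v) /\
  Dir a b p u v + Dir c d q u v = 2 * (kap u v * q u v - om u v * p u v) /\
  Dir a b om u v - Dir c d kap u v = - kap u v ^ 2 - om u v ^ 2 + W u v - 1.
Proof.
intros H.
destruct (structure_equations u v H) as
  [[aTT [bTT [aTl bTl]]] [[aBT [bBT [aBB [bBB [aBl bBl]]]]]
   [anT [bnT [anB [bnB [ann [bnn [anl bnl]]]]]]]]].
destruct (second_form_frame u v H) as [bBn [aBn _]].
pose proof (curvature_dot T n u v ST Sn H) as C1.
pose proof (curvature_dot B n u v SB Sn H) as C2.
pose proof (curvature_dot T B u v ST SB H) as C3.
rewrite (frame_parseval u v (VDir c d T u v) (VDir a b n u v) H),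
  (frame_parseval u v (VDir a b T u v) (VDir c d n u v) H) in C1.
rewrite (frame_parseval u v (VDir c d B u v) (VDir a b n u v) H),
  (frame_parseval u v (VDir a b B u v) (VDir c d n u v) H) in C2.
rewrite (frame_parseval u v (VDir c d T u v) (VDir a b B u v) H),
  (frame_parseval u v (VDir a b T u v) (VDir c d B u v) H) in C3.
rewrite aTT, bTT, aTl, bTl, anT, bnT, anB, bnB, ann, bnn, anl, bnl in C1.
rewrite aBT, bBT, aBB, bBB, aBl, bBl, bBn, aBn, anT, bnT, anB, bnB, ann, bnn, anl, bnl in C2.
rewrite aTT, bTT, aTl, bTl, aBT, bBT, aBB, bBB, aBl, bBl, bBn, aBn in C3.
change (fun x y => dot (VDir c d T x y) (n x y)) with q in C1.
change (fun x y => dot (VDir a b T x y) (n x y)) with p in C1.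
change (fun x y => dot (VDir c d T x y) (B x y)) with om in C3.
change (fun x y => dot (VDir a b T x y) (B x y)) with kap in C3.
rewrite (Dir_ext U openU a b (fun x y => dot (VDir c d B x y) (n x y)) (fun x y => -1 * p x y))
  in C2; [|intros x y Hxy; rewrite (proj1 (second_form_frame x y Hxy)); ring|exact H].
rewrite (Dir_ext U openU c d (fun x y => dot (VDir a b B x y) (n x y)) q)
  in C2; [|intros x y Hxy; exact (proj1 (proj2 (second_form_frame x y Hxy)))|exact H].
rewrite (Dir_mult U) in C2;
  [|now apply smooth_on_const|apply smooth_on_dot; auto; now apply smooth_vec_VDir|exact H].
rewrite Dir_const in C2.
fold (kap u v) (om u v) (p u v) (q u v) in C1, C2, C3.
unfold W; repeat split; lra.
Qed.


(** Since D_T D_T T is a multiple of T, its B and n components vanish. Hence T kap = <D_T T, D_T B>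
    and T p = <D_T T, D_T n>, which are expanded in the frame. *)
Lemma circle_connection u v k : U u v ->
  (forall i, (i < 4)%nat -> VDir a b (VDir a b T) u v i = k * T u v i) ->
  Dir a b kap u v = p u v * q u v /\ Dir a b p u v = - kap u v * q u v.
Proof.
intros H Hk.
assert (SaT : smooth_vec U (VDir a b T)) by now apply smooth_vec_VDir.
destruct (structure_equations u v H) as
  [[aTT [_ [aTl _]]] [[aBT [_ [aBB [_ [aBl _]]]]] [anT [_ [anB [_ [ann [_ [anl _]]]]]]]]].
destruct (second_form_frame u v H) as [_ [aBn _]].
destruct (frame_orthonormal u v H) as [_ [_ [_ [_ [TB [Tn _]]]]]].
assert (Dk : forall z, dot (VDir a b (VDir a b T) u v) z = k * dot (T u v) z).
{ intros z; rewrite (dot_lin_l k 0 (T u v) (T u v)); [ring|].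
  intros i Hi; rewrite (Hk i Hi); ring. }
unfold kap at 1, p at 2.
rewrite !(Dir_dot U openU) by auto.
rewrite !Dk, TB, Tn, (frame_parseval u v (VDir a b T u v) (VDir a b B u v) H),
  (frame_parseval u v (VDir a b T u v) (VDir a b n u v) H).
rewrite aTT, aTl, aBT, aBB, aBl, aBn, anT, anB, ann, anl.
fold (kap u v) (p u v); split; ring.
Qed.

(** In the principal frame II has the matrix (k, 0; 0, -k), so p = k (cos^2 - sin^2) = k cos(2
    theta) and W = k^2. The sign of k depends on which principal direction is taken at the point,
    hence the squares. *)
Lemma angle_condition u v theta s a1 b1 a2 b2 : U u v ->
  principal_dir l n u v a1 b1 ->
  Ibil l u v a1 b1 a1 b1 = 1 -> Ibil l u v a2 b2 a2 b2 = 1 -> Ibil l u v a1 b1 a2 b2 = 0 ->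
  a u v = s * (cos theta * a1 + sin theta * a2) ->
  b u v = s * (cos theta * b1 + sin theta * b2) ->
  p u v * p u v = cos (2 * theta) ^ 2 * W u v.
Proof.
intros H [_ [k [K1 K2]]] I1 I2 I12 Ea Eb.
destruct (first_form_frame u v H) as [_ nz].
assert (EW : W u v = (sM l n u v ^ 2 - sL l n u v * sN l n u v)
  / (fE l u v * fG l u v - fF l u v ^ 2)).
{ pose proof (gauss_equation u v H) as E1.
  rewrite (proj2 (proj2 (second_form_frame u v H))) in E1.
  replace (W u v) with (1 - (1 - W u v)) by ring; rewrite E1; field; exact nz. }
assert (tr : fE l u v * sN l n u v - 2 * fF l u v * sM l n u v + fG l u v * sL l n u v = 0)
  by now apply trace_zero.
unfold Ibil in I1, I2, I12.
destruct (traceless_form (fE l u v) (fF l u v) (fG l u v) (sL l n u v) (sM l n u v) (sN l n u v)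
  a1 b1 a2 b2) as [L22 EK]; try lra.
assert (L11 : sL l n u v * a1 ^ 2 + 2 * sM l n u v * a1 * b1 + sN l n u v * b1 ^ 2 = k).
{ transitivity (a1 * (sL l n u v * a1 + sM l n u v * b1) + b1 * (sM l n u v * a1 + sN l n u v * b1));
    [ring|rewrite K1, K2].
  transitivity (k * (fE l u v * a1 * a1 + fF l u v * (a1 * b1 + b1 * a1) + fG l u v * b1 * b1));
    [ring|rewrite I1; ring]. }
assert (L12 : sL l n u v * a1 * a2 + sM l n u v * (a1 * b2 + b1 * a2) + sN l n u v * b1 * b2 = 0).
{ transitivity (a2 * (sL l n u v * a1 + sM l n u v * b1) + b2 * (sM l n u v * a1 + sN l n u v * b1));
    [ring|rewrite K1, K2].
  transitivity (k * (fE l u v * a1 * a2 + fF l u v * (a1 * b2 + b1 * a2) + fG l u v * b1 * b2));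
    [ring|rewrite I12; ring]. }
rewrite L11 in L22; rewrite <- EW, L11, L12 in EK.
pose proof (sin2_cos2 theta) as sc; unfold Rsqr in sc.
(* T is a unit vector, and so is cos theta e1 + sin theta e2. *)
assert (s1 : s * s = 1).
{ pose proof (unitT u v H) as UT; rewrite Ea, Eb in UT.
  rewrite <- UT.
  transitivity (s * s * (cos theta * cos theta
      * (fE l u v * a1 * a1 + fF l u v * (a1 * b1 + b1 * a1) + fG l u v * b1 * b1)
    + 2 * cos theta * sin theta
      * (fE l u v * a1 * a2 + fF l u v * (a1 * b2 + b1 * a2) + fG l u v * b1 * b2)
    + sin theta * sin theta
      * (fE l u v * a2 * a2 + fF l u v * (a2 * b2 + b2 * a2) + fG l u v * b2 * b2))); [|ring].
  rewrite I1, I2, I12; transitivity (s * s * (sin theta * sin theta + cos theta * cos theta));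
    [rewrite sc|]; ring. }
assert (Ep : p u v = k * cos (2 * theta)).
{ unfold p, T; rewrite second_derivative_normal by assumption; rewrite Ea, Eb, cos_2a.
  match goal with |- ?g = _ => transitivity (s * s * (cos theta * cos theta *
    (sL l n u v * a1 ^ 2 + 2 * sM l n u v * a1 * b1 + sN l n u v * b1 ^ 2)
    + 2 * cos theta * sin theta *
    (sL l n u v * a1 * a2 + sM l n u v * (a1 * b2 + b1 * a2) + sN l n u v * b1 * b2)
    + sin theta * sin theta *
    (sL l n u v * a2 ^ 2 + 2 * sM l n u v * a2 * b2 + sN l n u v * b2 ^ 2))) end; [ring|].
  rewrite L11, L12, L22, s1; ring. }
rewrite Ep, <- EK; ring.
Qed.

Lemma gauss_curv_const C : connected_dom U -> 0 < C < 1 ->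
  (forall u v, U u v -> p u v * p u v = C * W u v) ->
  (forall u v, U u v -> exists k, forall i, (i < 4)%nat ->
     VDir a b (VDir a b T) u v i = k * T u v i) ->
  forall u v x y, U u v -> U x y -> gauss_curv l x y = gauss_curv l u v.
Proof.
intros conn HC angle circ u v x y Huv Hxy.
assert (SaT : smooth_vec U (VDir a b T)) by now apply smooth_vec_VDir.
assert (ScT : smooth_vec U (VDir c d T)) by now apply smooth_vec_VDir.
assert (Sp : smooth_on U p) by now apply smooth_on_dot.
assert (Sq : smooth_on U q) by now apply smooth_on_dot.
assert (Sk : smooth_on U kap) by now apply smooth_on_dot.
assert (So : smooth_on U om) by now apply smooth_on_dot.
assert (HW : forall u v, U u v -> W u v = p u v * p u v + q u v * q u v).
{ intros; unfold W; ring. }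
assert (SW : smooth_on U W).
{ apply (smooth_on_ext U openU _ (fun u v => p u v * p u v + q u v * q u v) HW).
  now apply smooth_on_plus; [|apply smooth_on_mult|apply smooth_on_mult]. }
assert (dW : forall u v, U u v -> Dir a b W u v = 0 /\ Dir c d W u v = 0).
{ apply (Dir_W_eq0 U a b c d p q kap om W C); auto.
  - intros; now apply frame_commutator.
  - intros; now apply codazzi_gauss.
  - intros; now apply codazzi_gauss.
  - intros; now apply codazzi_gauss.
  - intros u' v' H; destruct (circ u' v' H) as [k Hk]; now apply (circle_connection u' v' k).
  - intros u' v' H; destruct (circ u' v' H) as [k Hk]; now apply (circle_connection u' v' k). }
rewrite (proj2 (proj2 (second_form_frame u v Huv))), (proj2 (proj2 (second_form_frame x y Hxy))).
f_equal; apply (connected_const U openU W conn); auto; [now apply smooth_on_diff|].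
intros u' v' H; destruct (dW u' v' H) as [e1 e2]; unfold Dir in e1, e2.
destruct (first_form_frame u' v' H) as [HD _].
assert (nz : a u' v' * d u' v' - b u' v' * c u' v' <> 0).
{ intros Z; rewrite Z in HD; lra. }
(* Cramer's rule passes from the derivatives along T and B to the partial derivatives. *)
split; apply Rmult_eq_reg_l with (a u' v' * d u' v' - b u' v' * c u' v'); auto;
  rewrite Rmult_0_r.
- transitivity (d u' v' * (a u' v' * Du W u' v' + b u' v' * Dv W u' v')
    - b u' v' * (c u' v' * Du W u' v' + d u' v' * Dv W u' v')); [ring|rewrite e1, e2; ring].
- transitivity (a u' v' * (c u' v' * Du W u' v' + d u' v' * Dv W u' v')
    - c u' v' * (a u' v' * Du W u' v' + b u' v' * Dv W u' v')); [ring|rewrite e1, e2; ring].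
Qed.

End Frame.

(** * The frame adapted to the circles *)

Section Adapted_frame.

Variable U : R -> R -> Prop.
Variables l n : R -> R -> vec.
Variables X1 X2 : R -> R -> R.
Hypothesis openU : open_dom U.
Hypothesis minimal : minimal_surface_S3 U l n.
Hypothesis circles : circle_family U l X1 X2.

Let Sl : smooth_vec U l. Proof. apply minimal. Qed.
Let SX1 : smooth_on U X1. Proof. apply circles. Qed.
Let SX2 : smooth_on U X2. Proof. apply circles. Qed.

Definition speed u v :=
  sqrt (fE l u v * X1 u v ^ 2 + 2 * fF l u v * X1 u v * X2 u v + fG l u v * X2 u v ^ 2).
Definition area u v := sqrt (fE l u v * fG l u v - fF l u v ^ 2).

Definition tan1 u v := X1 u v * / speed u v.
Definition tan2 u v := X2 u v * / speed u v.
(** With [nor2], the rotation of the unit tangent by a right angle in the induced metric, written in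
    the coordinates u, v. *)
Definition nor1 u v := - (fF l u v * tan1 u v + fG l u v * tan2 u v) * / area u v.
Definition nor2 u v := (fE l u v * tan1 u v + fF l u v * tan2 u v) * / area u v.

Lemma first_form_pos u v x y : U u v -> x <> 0 \/ y <> 0 ->
  0 < fE l u v * x ^ 2 + 2 * fF l u v * x * y + fG l u v * y ^ 2.
Proof.
intros H nz; set (Z := fun i => x * VDu l u v i + y * VDv l u v i).
replace (_ + _) with (dot Z Z) by (unfold Z, fE, fF, fG, dot; ring).
destruct minimal as [_ [_ [_ [indep _]]]].
destruct (Rle_lt_or_eq_dec 0 (dot Z Z)) as [L|E]; [unfold dot; nra|exact L|].
destruct (indep u v H x y (dot_self_eq0 Z (eq_sym E))); tauto.
Qed.

Lemma first_form_det_pos u v : U u v -> 0 < fE l u v * fG l u v - fF l u v ^ 2.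
Proof.
intros H.
pose proof (first_form_pos u v 1 0 H (or_introl R1_neq_R0)) as E.
replace (_ + _) with (fE l u v) in E by ring.
assert (nz : fE l u v <> 0) by lra.
(* The vector with coordinates (-F, E) is orthogonal to l_u, and its squared length is E (E G -
   F^2). *)
pose proof (first_form_pos u v (- fF l u v) (fE l u v) H (or_intror nz)) as D.
apply Rmult_lt_reg_l with (fE l u v); [exact E|].
match type of D with 0 < ?r => replace r with (fE l u v * (fE l u v * fG l u v - fF l u v ^ 2))
  in D by ring end; lra.
Qed.

Lemma speed_pos u v : U u v -> 0 < speed u v.
Proof. intros H; apply sqrt_lt_R0, first_form_pos; [exact H|]; now apply circles. Qed.

Lemma area_pos u v : U u v -> 0 < area u v.
Proof. intros H; now apply sqrt_lt_R0, first_form_det_pos. Qed.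

Lemma smooth_first_form : smooth_on U (fE l) /\ smooth_on U (fF l) /\ smooth_on U (fG l).
Proof.
pose proof (smooth_vec_VDu U l Sl); pose proof (smooth_vec_VDv U l Sl).
split; [|split]; now apply smooth_on_dot.
Qed.

Lemma smooth_tangent : smooth_on U tan1 /\ smooth_on U tan2.
Proof.
destruct smooth_first_form as [SE [SF SG]].
assert (Ss : smooth_on U (fun u v => / speed u v)).
{ apply smooth_on_inv; [exact openU|intros u v H; apply Rgt_not_eq; now apply speed_pos|].
  apply smooth_on_sqrt; [exact openU| |].
  - intros u v H; apply first_form_pos; [exact H|]; now apply circles.
  - unfold pow; smooth. }
split; now apply smooth_on_mult.
Qed.

Lemma smooth_normal : smooth_on U nor1 /\ smooth_on U nor2.
Proof.
destruct smooth_first_form as [SE [SF SG]]; destruct smooth_tangent as [S1 S2].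
assert (Sa : smooth_on U (fun u v => / area u v)).
{ apply smooth_on_inv; [exact openU|intros u v H; apply Rgt_not_eq; now apply area_pos|].
  apply smooth_on_sqrt; [exact openU|apply first_form_det_pos|].
  unfold pow; smooth. }
split; apply smooth_on_mult; auto; [apply smooth_on_opp; auto|];
  apply smooth_on_plus; auto; now apply smooth_on_mult.
Qed.

Lemma adapted_orthonormal u v : U u v ->
  fE l u v * tan1 u v ^ 2 + 2 * fF l u v * tan1 u v * tan2 u v + fG l u v * tan2 u v ^ 2 = 1 /\
  fE l u v * nor1 u v ^ 2 + 2 * fF l u v * nor1 u v * nor2 u v + fG l u v * nor2 u v ^ 2 = 1 /\
  fE l u v * tan1 u v * nor1 u v + fF l u v * (tan1 u v * nor2 u v + tan2 u v * nor1 u v)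
  + fG l u v * tan2 u v * nor2 u v = 0.
Proof.
intros H.
pose proof (speed_pos u v H) as Ps; pose proof (area_pos u v H) as Pa.
assert (Es : speed u v * speed u v =
  fE l u v * X1 u v ^ 2 + 2 * fF l u v * X1 u v * X2 u v + fG l u v * X2 u v ^ 2).
{ apply sqrt_sqrt, Rlt_le, first_form_pos; [exact H|]; now apply circles. }
assert (Ea : area u v * area u v = fE l u v * fG l u v - fF l u v ^ 2).
{ apply sqrt_sqrt, Rlt_le; now apply first_form_det_pos. }
assert (H1 : fE l u v * tan1 u v ^ 2 + 2 * fF l u v * tan1 u v * tan2 u v
  + fG l u v * tan2 u v ^ 2 = 1).
{ unfold tan1, tan2.
  transitivity ((fE l u v * X1 u v ^ 2 + 2 * fF l u v * X1 u v * X2 u v + fG l u v * X2 u v ^ 2)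
    / (speed u v * speed u v)); [field; lra|rewrite <- Es; field; lra]. }
split; [exact H1|split]; unfold nor1, nor2.
- transitivity ((fE l u v * fG l u v - fF l u v ^ 2)
    * (fE l u v * tan1 u v ^ 2 + 2 * fF l u v * tan1 u v * tan2 u v + fG l u v * tan2 u v ^ 2)
    / (area u v * area u v)); [field; lra|rewrite H1, Ea, <- Ea; field; lra].
- ring.
Qed.

Let T := VDir tan1 tan2 l.

Lemma Dir_tangent f u v : U u v ->
  X1 u v * Du f u v + X2 u v * Dv f u v = speed u v * Dir tan1 tan2 f u v.
Proof. intros H; pose proof (speed_pos u v H); unfold Dir, tan1, tan2; field; lra. Qed.

(** Along the integral curve, d/dt is [speed] times the derivative along T, so the Frenet equations
    read D_T T = k1 N and D_T N = - k1 T. The first must hold on a whole interval before it can be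
    differentiated; the factor k may change from circle to circle. *)
Lemma circle_third_derivative u v : U u v ->
  exists k, forall i, (i < 4)%nat -> VDir tan1 tan2 (VDir tan1 tan2 T) u v i = k * T u v i.
Proof.
intros H; destruct smooth_tangent as [S1 S2].
assert (ST : smooth_vec U T) by now apply smooth_vec_VDir.
assert (SaT : smooth_vec U (VDir tan1 tan2 T)) by now apply smooth_vec_VDir.
destruct circles as [_ [_ [_ cir]]].
destruct (cir u v H) as [e [g1 [g2 [He [G1 [G2 [flow [c' [k1 [N [_ fr]]]]]]]]]]].
assert (chain : forall f t, smooth_on U f -> - e < t < e ->
  is_derive (fun s => f (g1 s) (g2 s)) t (speed (g1 t) (g2 t) * Dir tan1 tan2 f (g1 t) (g2 t))).
{ intros f t Hf Ht; destruct (flow t Ht) as [Ut [D1 D2]].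
  rewrite <- Dir_tangent by exact Ut; now apply (is_derive_comp_2d U). }
assert (near : forall t, - e < t < e -> locally t (fun s => - e < s < e)).
{ intros t Ht; apply (open_and (fun s => - e < s) (fun s => s < e)); auto;
    [apply open_gt | apply open_lt]. }
assert (velocity : forall t i, - e < t < e -> (i < 4)%nat ->
  c' t i = speed (g1 t) (g2 t) * T (g1 t) (g2 t) i).
{ intros t i Ht Hi; destruct (fr t Ht) as [Dc _].
  rewrite <- (is_derive_unique _ _ _ (Dc i Hi)); apply is_derive_unique.
  apply (chain (fun x y => l x y i)); [exact (Sl i Hi) | exact Ht]. }
assert (norm : forall t, - e < t < e -> nrm (c' t) = speed (g1 t) (g2 t)).
{ intros t Ht; destruct (flow t Ht) as [Ut _]; pose proof (speed_pos _ _ Ut) as Ps.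
  destruct (adapted_orthonormal _ _ Ut) as [TT _].
  rewrite <- (sqrt_square (speed (g1 t) (g2 t))) by lra; unfold nrm; f_equal.
  transitivity (speed (g1 t) (g2 t) * speed (g1 t) (g2 t)
    * (dot (T (g1 t) (g2 t)) (T (g1 t) (g2 t)))).
  - unfold dot; rewrite !velocity by (auto; lia); ring.
  - transitivity (speed (g1 t) (g2 t) * speed (g1 t) (g2 t) * 1); [f_equal|ring].
    rewrite <- TT; unfold T, VDir, Dir, fE, fF, fG, VDu, VDv, dot; ring. }
assert (curvature : forall t i, - e < t < e -> (i < 4)%nat ->
  VDir tan1 tan2 T (g1 t) (g2 t) i = k1 * N t i).
{ intros t i Ht Hi; destruct (fr t Ht) as [_ [_ [DT _]]].
  destruct (flow t Ht) as [Ut _]; pose proof (speed_pos _ _ Ut) as Ps.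
  apply Rmult_eq_reg_l with (speed (g1 t) (g2 t)); [|lra].
  transitivity (nrm (c' t) * k1 * N t i); [|rewrite norm by exact Ht; ring].
  rewrite <- (is_derive_unique _ _ _ (DT i Hi)).
  symmetry; apply is_derive_unique.
  apply is_derive_ext_loc with (fun s => T (g1 s) (g2 s) i).
  - generalize (near t Ht); apply filter_imp; intros s Hs.
    rewrite norm, velocity by assumption.
    destruct (flow s Hs) as [Us _]; pose proof (speed_pos _ _ Us) as Pss.
    match goal with |- ?x = ?y => change (@eq R x y) end; field; lra.
  - apply (chain (fun x y => T x y i)); [exact (ST i Hi) | exact Ht]. }
(* The field D_T T equals the product k1 N, and it is this product that is differentiated at t = 0,
   which covers k1 = 0 as well. *)
exists (- (k1 * k1)); intros i Hi; subst u v.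
assert (H0 : - e < 0 < e) by lra.
pose proof (speed_pos _ _ H) as Ps.
destruct (fr 0 H0) as [_ [_ [_ [_ DN]]]].
apply Rmult_eq_reg_l with (speed (g1 0) (g2 0)); [|lra].
transitivity (Derive (fun s => VDir tan1 tan2 T (g1 s) (g2 s) i) 0).
- symmetry; apply is_derive_unique.
  apply (chain (fun x y => VDir tan1 tan2 T x y i)); [exact (SaT i Hi) | exact H0].
- transitivity (Derive (fun s => k1 * N s i) 0).
  + apply Derive_ext_loc; generalize (near 0 H0); apply filter_imp; intros s Hs.
    now apply curvature.
  + assert (E : Derive (fun s => N s i) 0 = - (nrm (c' 0) * k1) * (c' 0 i / nrm (c' 0)))
      by exact (is_derive_unique _ _ _ (DN i Hi)).
    rewrite Derive_scal, E, norm, velocity by assumption.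
    field; lra.
Qed.

Lemma constant_curvature theta : connected_dom U ->
  cos (2 * theta) <> 0 -> sin (2 * theta) <> 0 ->
  (forall u v, U u v -> crosses_principal_at_angle l n theta u v (X1 u v) (X2 u v)) ->
  forall u v x y, U u v -> U x y -> gauss_curv l x y = gauss_curv l u v.
Proof.
intros conn nc ns cross.
destruct smooth_tangent as [S1 S2]; destruct smooth_normal as [S3 S4].
apply (gauss_curv_const U l n tan1 tan2 nor1 nor2 openU minimal S1 S2 S3 S4
  (fun u v H => proj1 (adapted_orthonormal u v H))
  (fun u v H => proj1 (proj2 (adapted_orthonormal u v H)))
  (fun u v H => proj2 (proj2 (adapted_orthonormal u v H)))
  (cos (2 * theta) ^ 2) conn).
(* The squares of cos(2 theta) and sin(2 theta) are positive with sum 1, so the first lies strictly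
   between 0 and 1. *)
- pose proof (sin2_cos2 (2 * theta)) as sc; unfold Rsqr in sc.
  assert (0 < cos (2 * theta) * cos (2 * theta)) by nra.
  assert (0 < sin (2 * theta) * sin (2 * theta)) by nra.
  simpl; lra.
- intros u v H.
  destruct (cross u v H) as [a1 [b1 [a2 [b2 [lam [pr [I1 [I2 [I12 [E1 E2]]]]]]]]]].
  apply (angle_condition U l n tan1 tan2 nor1 nor2 openU minimal S1 S2 S3 S4
    (fun u v H => proj1 (adapted_orthonormal u v H))
    (fun u v H => proj1 (proj2 (adapted_orthonormal u v H)))
    (fun u v H => proj2 (proj2 (adapted_orthonormal u v H)))
    u v theta (lam * / speed u v) a1 b1 a2 b2); auto.
  + unfold tan1; rewrite E1; ring.
  + unfold tan2; rewrite E2; ring.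
- exact circle_third_derivative.
Qed.

End Adapted_frame.

(** * The exceptional angles and the conclusion *)

Lemma cos_2a_eq0 theta : 0 <= theta < PI -> cos (2 * theta) = 0 ->
  theta = PI / 4 \/ theta = 3 * PI / 4.
Proof.
intros Hth E; pose proof PI_RGT_0.
destruct (cos_eq_0_2PI_0 (2 * theta)); lra.
Qed.

Lemma sin_2a_eq0 theta : 0 <= theta < PI -> sin (2 * theta) = 0 ->
  theta = 0 \/ theta = PI / 2.
Proof.
intros Hth E; pose proof PI_RGT_0.
destruct (sin_eq_O_2PI_0 (2 * theta)) as [|[|]]; lra.
Qed.

Theorem theorem2p2 (U : R -> R -> Prop) (l n : R -> R -> vec)
  (X1 X2 : R -> R -> R) (theta : R) :
  open_dom U -> connected_dom U ->
  minimal_surface_S3 U l n ->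
  ~ (exists K0 : R, forall u v, U u v -> gauss_curv l u v = K0) ->
  circle_family U l X1 X2 ->
  0 <= theta < PI ->
  (forall u v, U u v -> crosses_principal_at_angle l n theta u v (X1 u v) (X2 u v)) ->
  theta = 0 \/ theta = PI / 2 \/ theta = PI / 4 \/ theta = 3 * PI / 4.
Proof.
intros openU conn minimal nK circles Hth cross.
destruct (Req_dec (cos (2 * theta)) 0) as [c0|nc].
{ destruct (cos_2a_eq0 theta Hth c0); auto. }
destruct (Req_dec (sin (2 * theta)) 0) as [s0|ns].
{ destruct (sin_2a_eq0 theta Hth s0); auto. }
exfalso; apply nK.
(* The constant is the curvature at some point of [U]; if [U] is empty, any constant serves and 0 is
   taken. *)
destruct (classic (exists u v, U u v)) as [[u [v H]]|empty].
- exists (gauss_curv l u v); intros x y Hxy.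
  now apply (constant_curvature U l n X1 X2 openU minimal circles theta conn nc ns cross).
- exists 0; intros u v H; exfalso; apply empty; eauto.
Qed.
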